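(* Let $\mathcal G$ be a topological $2$-group and $X$ a topological space. The map $\Gamma\colon\check H(X,\mathcal G)\to\mathcal P(X,\mathcal G)$ defined below is surjective. Moreover, if $X$ admits good covers, then $\Gamma$ is bijective.
   Context: Topological $2$-group $\mathcal G=(\mathcal G_1\rightrightarrows\mathcal G_0)$, $\mathcal E=\mathrm{Ker}(s)$, ${}^xe=1_xe1_{x^{-1}}$. For an open cover $\mathcal U=\{U_i\}$ of $X$, a $\mathcal G$-valued Čech cocycle is $c=(\mathbf x,\mathbf e)$, $\mathbf x_{ij}\colon U_i\cap U_j\to\mathcal G_0$, $\mathbf e_{ijk}\colon U_i\cap U_j\cap U_k\to\mathcal E$ continuous with $t(\mathbf e_{ijk})\mathbf x_{ij}\mathbf x_{jk}=\mathbf x_{ik}$, $\mathbf e_{ikl}\mathbf e_{ijk}=\mathbf e_{ijl}\,{}^{\mathbf x_{ij}}\mathbf e_{jkl}$; two are cohomologous if there are continuous $a_i\colon U_i\to\mathcal G_0$, $d_{ij}\colon U_i\cap U_j\to\mathcal E$ with $\mathbf x'_{ij}=a_it(d_{ij})\mathbf x_{ij}a_j^{-1}$, $\mathbf e'_{ijk}={}^{a_i}(d_{ik}\mathbf e_{ijk}\,{}^{\mathbf x_{ij}}(d_{jk}^{-1})d_{ij}^{-1})$. $\check H(\mathcal U,\mathcal G)$ is the set of classes and $\check H(X,\mathcal G)=\varinjlim_{\mathcal U}\check H(\mathcal U,\mathcal G)$ over open covers with restriction maps, with cocone maps $\kappa_{\mathcal U}$. $\mathcal P(X,\mathcal G)$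 is the set of equivalence classes of principal $\mathcal G$-bundles over $X$ (continuous functors $\pi\colon P\to\overline X$ from $\mathcal G$-$2$-spaces admitting an atlas of trivializing charts, i.e. $\mathcal G$-equivalences $P|_{U_i}\simeq\overline{U_i}\times\mathcal G$ over $\overline{U_i}$ with $\mathcal G_0$-equivariant natural isomorphisms), where $\pi,\pi'$ are equivalent if there is a principal $\mathcal G$-bundle $\tilde\pi$ and $\mathcal G$-bundle morphisms ($\mathcal G$-equivariant continuous functors commuting with projections) $\tilde\pi\to\pi$, $\tilde\pi\to\pi'$. To a cocycle $c$ corresponds the principal bundle $\pi_c\colon P_c\to\overline X$ with objects $(u,x)_i\in\coprod U_i\times\mathcal G_0$, morphisms $(v,g)_{ij}\in\coprod(U_i\cap U_j)\times\mathcal G_1$, $s((v,g)_{ij})=(v,s(g))_i$, $t((v,g)_{ij})=(v,\mathbf x_{ij}(v)^{-1}t(g))_j$, product $(v,g)_{ij}*(v,h)_{jk}=(v,\mathbf e_{ijk}(v)(g*(1_{\mathbf x_{ij}(v)}h)))_{ik}$ ($g*h=h1_{t(g)^{-1}}g$), right multiplication action, projection to $X$. The maps $\check H(\mathcal U,\mathcal G)\to\mathcal P(X,\mathcal G)$, $[c]\mapsto[\pi_c]$, are well defined and compatible with restriction, and $\Gamma$ is the unique map with $\Gamma\circ\kappa_{\mathcal U}([c])=[\pi_c]$ for all $\mathcal U$ and $c$. $X$ admits good covers if every open cover has a refinement by an open cover all of whose nonempty finite intersections are contractible. *)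

(* Defs.v *)
From HB Require Import structures.
From Stdlib Require Import Relations.
From mathcomp Require Import all_boot all_order all_algebra.
From mathcomp Require Import all_classical.
From mathcomp Require Import topology.
From mathcomp Require Import Rstruct Rstruct_topology.

Set Implicit Arguments.
Unset Strict Implicit.
Unset Printing Implicit Defensive.

Import Order.TTheory GRing.Theory Num.Theory.
Local Open Scope classical_set_scope.

Record twoGroup := TwoGroup {
  G0 : topologicalType;
  G1 : topologicalType;
  mul0 : G0 -> G0 -> G0; inv0 : G0 -> G0; one0 : G0;
  mul1 : G1 -> G1 -> G1; inv1 : G1 -> G1; one1 : G1;
  src : G1 -> G0; tgt : G1 -> G0; idn : G0 -> G1;
  cmp : G1 -> G1 -> G1; cinv : G1 -> G1;
  mul0A : forall x y z, mul0 x (mul0 y z) = mul0 (mul0 x y) z;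
  mul01x : forall x, mul0 one0 x = x;
  mul0x1 : forall x, mul0 x one0 = x;
  mul0Vx : forall x, mul0 (inv0 x) x = one0;
  mul0xV : forall x, mul0 x (inv0 x) = one0;
  mul1A : forall x y z, mul1 x (mul1 y z) = mul1 (mul1 x y) z;
  mul11x : forall x, mul1 one1 x = x;
  mul1x1 : forall x, mul1 x one1 = x;
  mul1Vx : forall x, mul1 (inv1 x) x = one1;
  mul1xV : forall x, mul1 x (inv1 x) = one1;
  src_idn : forall x, src (idn x) = x;
  tgt_idn : forall x, tgt (idn x) = x;
  src_cmp : forall g h, tgt g = src h -> src (cmp g h) = src g;
  tgt_cmp : forall g h, tgt g = src h -> tgt (cmp g h) = tgt h;
  cmpA : forall g h k, tgt g = src h -> tgt h = src k ->
    cmp g (cmp h k) = cmp (cmp g h) k;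
  cmp_idl : forall g, cmp (idn (src g)) g = g;
  cmp_idr : forall g, cmp g (idn (tgt g)) = g;
  src_cinv : forall g, src (cinv g) = tgt g;
  tgt_cinv : forall g, tgt (cinv g) = src g;
  cmp_cinv : forall g, cmp g (cinv g) = idn (src g);
  cinv_cmp : forall g, cmp (cinv g) g = idn (tgt g);
  src_mul : forall g h, src (mul1 g h) = mul0 (src g) (src h);
  tgt_mul : forall g h, tgt (mul1 g h) = mul0 (tgt g) (tgt h);
  idn_mul : forall x y, idn (mul0 x y) = mul1 (idn x) (idn y);
  interchange : forall g h g' h', tgt g = src h -> tgt g' = src h' ->
    mul1 (cmp g h) (cmp g' h') = cmp (mul1 g g') (mul1 h h');
  one1E : one1 = idn one0;
  src_inv : forall g, src (inv1 g) = inv0 (src g);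
  tgt_inv : forall g, tgt (inv1 g) = inv0 (tgt g);
  idn_inv : forall x, idn (inv0 x) = inv1 (idn x);
  inv_cmp : forall g h, tgt g = src h -> inv1 (cmp g h) = cmp (inv1 g) (inv1 h);
  mul0_cont : continuous (fun p : G0 * G0 => mul0 p.1 p.2);
  inv0_cont : continuous inv0;
  mul1_cont : continuous (fun p : G1 * G1 => mul1 p.1 p.2);
  inv1_cont : continuous inv1;
  src_cont : continuous src;
  tgt_cont : continuous tgt;
  idn_cont : continuous idn;
  cinv_cont : continuous cinv;
  cmp_cont : {within [set p : G1 * G1 | tgt p.1 = src p.2],
               continuous (fun p : G1 * G1 => cmp p.1 p.2)}
}.

Arguments mul0 {_}. Arguments inv0 {_}. Arguments one0 {_}.
Arguments mul1 {_}. Arguments inv1 {_}. Arguments one1 {_}.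
Arguments src {_}. Arguments tgt {_}. Arguments idn {_}.
Arguments cmp {_}. Arguments cinv {_}.

Definition conj (G : twoGroup) (x : G0 G) (e : G1 G) : G1 G :=
  mul1 (mul1 (idn x) e) (idn (inv0 x)).

(* G-2-spaces over X (data).  A topological groupoid is given by       *)
(* ambient spaces [ob], [mor] together with the subspaces [obS], [morS] *)
(* of actual objects/morphisms (so that subspaces such as P|_U and the  *)
(* coproducts used for P_c are expressible); composition [cP f g] is    *)
(* "first f, then g".  [act0]/[act1] is the right action functor        *)
(* P x G -> P and [proj] the projection functor P -> Xbar (on objects;  *)
(* Xbar has only identity morphisms).                                   *)
Record space2 (G : twoGroup) (X : topologicalType) := Space2 {
  ob : topologicalType;
  mor : topologicalType;
  obS : set ob;
  morS : set mor;
  sP : mor -> ob;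
  tP : mor -> ob;
  cP : mor -> mor -> mor;
  act0 : ob -> G0 G -> ob;
  act1 : mor -> G1 G -> mor;
  proj : ob -> X
}.

Arguments obS {_ _ _}. Arguments morS {_ _ _}. Arguments sP {_ _ _}.
Arguments tP {_ _ _}. Arguments cP {_ _ _}. Arguments act0 {_ _ _}.
Arguments act1 {_ _ _}. Arguments proj {_ _ _}.

Section Spaces.
Variables (G : twoGroup) (X : topologicalType).

Definition composable (P : space2 G X) (f g : mor P) :=
  morS f /\ morS g /\ tP f = sP g.

Record is_2space (P : space2 G X) : Prop := {
  sP_in : forall f : mor P, morS f -> obS (sP f);
  tP_in : forall f : mor P, morS f -> obS (tP f);
  cP_in : forall f g : mor P, composable f g -> morS (cP f g);
  sP_cP : forall f g : mor P, composable f g -> sP (cP f g) = sP f;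
  tP_cP : forall f g : mor P, composable f g -> tP (cP f g) = tP g;
  cPA : forall f g h : mor P, composable f g -> composable g h ->
    cP f (cP g h) = cP (cP f g) h;
  units_inverses : exists (e : ob P -> mor P) (iv : mor P -> mor P),
    (forall p : ob P, obS p -> morS (e p) /\ sP (e p) = p /\ tP (e p) = p) /\
    (forall f : mor P, morS f -> cP (e (sP f)) f = f /\ cP f (e (tP f)) = f) /\
    (forall f : mor P, morS f -> morS (iv f) /\ sP (iv f) = tP f /\ tP (iv f) = sP f
        /\ cP f (iv f) = e (sP f) /\ cP (iv f) f = e (tP f)) /\
    {within obS, continuous e} /\ {within morS, continuous iv};
  sP_cont : {within morS, continuous (@sP _ _ P)};
  tP_cont : {within morS, continuous (@tP _ _ P)};
  cP_cont : {within [set p : mor P * mor P | composable p.1 p.2],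
              continuous (fun p : mor P * mor P => cP p.1 p.2)};
  act0_in : forall (p : ob P) (x : G0 G), obS p -> obS (act0 p x);
  act1_in : forall (f : mor P) (g : G1 G), morS f -> morS (act1 f g);
  sP_act : forall (f : mor P) (g : G1 G), morS f -> sP (act1 f g) = act0 (sP f) (src g);
  tP_act : forall (f : mor P) (g : G1 G), morS f -> tP (act1 f g) = act0 (tP f) (tgt g);
  act_cP : forall (f f' : mor P) (g g' : G1 G), composable f f' -> tgt g = src g' ->
    act1 (cP f f') (cmp g g') = cP (act1 f g) (act1 f' g');
  act0_1 : forall p : ob P, obS p -> act0 p one0 = p;
  act0_mul : forall (p : ob P) (x y : G0 G), obS p -> act0 (act0 p x) y = act0 p (mul0 x y);
  act1_1 : forall f : mor P, morS f -> act1 f one1 = f;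
  act1_mul : forall (f : mor P) (g h : G1 G), morS f -> act1 (act1 f g) h = act1 f (mul1 g h);
  act0_cont : {within [set p : ob P * G0 G | obS p.1],
                continuous (fun p : ob P * G0 G => act0 p.1 p.2)};
  act1_cont : {within [set p : mor P * G1 G | morS p.1],
                continuous (fun p : mor P * G1 G => act1 p.1 p.2)};
  proj_functor : forall f : mor P, morS f -> proj (sP f) = proj (tP f);
  proj_cont : {within obS, continuous (@proj _ _ P)}
}.

(* A trivializing chart of P over U: a G-equivalence P|_U ~ Ubar x G     *)
(* over Ubar, i.e. G-equivariant continuous functors                    *)
(*   phi : P|_U -> Ubar x G,  p |-> (proj p, phi0 p), f |-> (proj, phi1 f) *)
(*   psi : Ubar x G -> P|_U,  (u,x) |-> psi0 u x, (u,g) |-> psi1 u g      *)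
(* commuting with the projections, with G0-equivariant continuous       *)
(* natural isomorphisms eta : psi o phi => id and eps : phi o psi => id. *)
Definition chart (P : space2 G X) (U : set X) : Prop :=
  let obU := [set p | obS p /\ U (proj p)] in
  let morU := [set f | morS f /\ U (proj (sP f))] in
  exists (phi0 : ob P -> G0 G) (phi1 : mor P -> G1 G)
         (psi0 : X -> G0 G -> ob P) (psi1 : X -> G1 G -> mor P)
         (eta : ob P -> mor P) (eps : X -> G0 G -> G1 G),
  (forall f : mor P, morU f -> src (phi1 f) = phi0 (sP f) /\ tgt (phi1 f) = phi0 (tP f)) /\
  (forall f g : mor P, composable f g -> U (proj (sP f)) ->
      phi1 (cP f g) = cmp (phi1 f) (phi1 g)) /\
  (forall (p : ob P) (x : G0 G), obU p -> phi0 (act0 p x) = mul0 (phi0 p) x) /\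
  (forall (f : mor P) (g : G1 G), morU f -> phi1 (act1 f g) = mul1 (phi1 f) g) /\
  {within obU, continuous phi0} /\ {within morU, continuous phi1} /\
  (forall (u : X) (x : G0 G), U u -> obS (psi0 u x) /\ proj (psi0 u x) = u) /\
  (forall (u : X) (g : G1 G), U u -> morS (psi1 u g) /\ sP (psi1 u g) = psi0 u (src g)
                     /\ tP (psi1 u g) = psi0 u (tgt g)) /\
  (forall (u : X) (g h : G1 G), U u -> tgt g = src h ->
      psi1 u (cmp g h) = cP (psi1 u g) (psi1 u h)) /\
  (forall (u : X) (x y : G0 G), U u -> psi0 u (mul0 x y) = act0 (psi0 u x) y) /\
  (forall (u : X) (g h : G1 G), U u -> psi1 u (mul1 g h) = act1 (psi1 u g) h) /\
  {within [set q : X * G0 G | U q.1], continuous (fun q : X * G0 G => psi0 q.1 q.2)} /\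
  {within [set q : X * G1 G | U q.1], continuous (fun q : X * G1 G => psi1 q.1 q.2)} /\
  (forall p : ob P, obU p -> morS (eta p) /\ sP (eta p) = psi0 (proj p) (phi0 p)
                     /\ tP (eta p) = p) /\
  (forall f : mor P, morU f ->
      cP (eta (sP f)) f = cP (psi1 (proj (sP f)) (phi1 f)) (eta (tP f))) /\
  (forall (p : ob P) (x : G0 G), obU p -> eta (act0 p x) = act1 (eta p) (idn x)) /\
  {within obU, continuous eta} /\
  (forall (u : X) (x : G0 G), U u -> src (eps u x) = phi0 (psi0 u x) /\ tgt (eps u x) = x) /\
  (forall (u : X) (g : G1 G), U u ->
      cmp (eps u (src g)) g = cmp (phi1 (psi1 u g)) (eps u (tgt g))) /\
  (forall (u : X) (x y : G0 G), U u -> eps u (mul0 x y) = mul1 (eps u x) (idn y)) /\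
  {within [set q : X * G0 G | U q.1], continuous (fun q : X * G0 G => eps q.1 q.2)}.

Definition principal (P : space2 G X) : Prop :=
  is_2space P /\
  exists (I : Type) (U : I -> set X),
    (forall i, open (U i)) /\ (forall x, exists i, U i x) /\
    (forall i, chart P (U i)).

Definition bundle_morphism (P Q : space2 G X) : Prop :=
  exists (F0 : ob P -> ob Q) (F1 : mor P -> mor Q),
  (forall p : ob P, obS p -> obS (F0 p)) /\
  (forall f : mor P, morS f -> morS (F1 f) /\ sP (F1 f) = F0 (sP f) /\ tP (F1 f) = F0 (tP f)) /\
  (forall f g : mor P, composable f g -> F1 (cP f g) = cP (F1 f) (F1 g)) /\
  (forall (p : ob P) (x : G0 G), obS p -> F0 (act0 p x) = act0 (F0 p) x) /\
  (forall (f : mor P) (g : G1 G), morS f -> F1 (act1 f g) = act1 (F1 f) g) /\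
  (forall p : ob P, obS p -> proj (F0 p) = proj p) /\
  {within obS, continuous F0} /\ {within morS, continuous F1}.

(* the elementary relation between principal bundles, and the            *)
(* equivalence relation it generates (P(X,G) is the quotient by it)      *)
Definition bundle_span (P Q : space2 G X) : Prop :=
  principal P /\ principal Q /\
  exists R : space2 G X, principal R /\ bundle_morphism R P /\ bundle_morphism R Q.

Definition bundle_equiv : relation (space2 G X) :=
  clos_refl_sym_trans (space2 G X) bundle_span.

End Spaces.

Record ocover (X : topologicalType) := OCover {
  cidx : Type;
  cset : cidx -> set X;
  cset_open : forall i, open (cset i);
  cset_cover : forall x, exists i, cset i x
}.
Arguments cidx {_}. Arguments cset {_}.

Record cocycle (G : twoGroup) (X : topologicalType) (U : ocover X) := Cocycle {
  cx : cidx U -> cidx U -> X -> G0 G;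
  ce : cidx U -> cidx U -> cidx U -> X -> G1 G
}.
Arguments cx {_ _ _}. Arguments ce {_ _ _}.

Section Cech.
Variables (G : twoGroup) (X : topologicalType).

Definition is_cocycle (U : ocover X) (c : cocycle G U) : Prop :=
  (forall i j, {within cset U i `&` cset U j, continuous (cx c i j)}) /\
  (forall i j k, {within cset U i `&` cset U j `&` cset U k, continuous (ce c i j k)}) /\
  (forall i j k v, cset U i v -> cset U j v -> cset U k v ->
     src (ce c i j k v) = one0 /\
     mul0 (mul0 (tgt (ce c i j k v)) (cx c i j v)) (cx c j k v) = cx c i k v) /\
  (forall i j k l v, cset U i v -> cset U j v -> cset U k v -> cset U l v ->
     mul1 (ce c i k l v) (ce c i j k v)
     = mul1 (ce c i j l v) (conj (cx c i j v) (ce c j k l v))).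

Definition cohomologous (U : ocover X) (c c' : cocycle G U) : Prop :=
  exists (a : cidx U -> X -> G0 G) (d : cidx U -> cidx U -> X -> G1 G),
  (forall i, {within cset U i, continuous (a i)}) /\
  (forall i j, {within cset U i `&` cset U j, continuous (d i j)}) /\
  (forall i j v, cset U i v -> cset U j v ->
     src (d i j v) = one0 /\
     cx c' i j v = mul0 (mul0 (mul0 (a i v) (tgt (d i j v))) (cx c i j v)) (inv0 (a j v))) /\
  (forall i j k v, cset U i v -> cset U j v -> cset U k v ->
     ce c' i j k v =
     conj (a i v) (mul1 (mul1 (mul1 (d i k v) (ce c i j k v))
                             (conj (cx c i j v) (inv1 (d j k v))))
                        (inv1 (d i j v)))).

Definition restrict (U V : ocover X) (lam : cidx V -> cidx U) (c : cocycle G U)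
  : cocycle G V :=
  Cocycle (fun j j' => cx c (lam j) (lam j'))
          (fun j j' j'' => ce c (lam j) (lam j') (lam j'')).

Definition cech_data := {U : ocover X & cocycle G U}.

(* generating steps of the equality in
   Ȟ(X,G) = colim_U Ȟ(U,G), Ȟ(U,G) = cocycles / cohomology *)
Definition cech_step (a b : cech_data) : Prop :=
  (exists (U : ocover X) (c c' : cocycle G U),
     is_cocycle c /\ is_cocycle c' /\ cohomologous c c' /\
     a = existT _ U c /\ b = existT _ U c') \/
  (exists (U V : ocover X) (lam : cidx V -> cidx U) (c : cocycle G U),
     is_cocycle c /\ (forall j, cset V j `<=` cset U (lam j)) /\
     a = existT _ U c /\ b = existT _ V (restrict lam c)).

Definition cech_eq : relation cech_data := clos_refl_sym_trans cech_data cech_step.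

(* the principal bundle pi_c : P_c -> Xbar associated with a cocycle.    *)
(* Objects (u,x)_i are ((i,u),x) with u in U_i; morphisms (v,g)_ij are    *)
(* (((i,j),v),g) with v in U_i ∩ U_j; the index set carries the discrete *)
(* topology, so that these are the coproducts ∐ U_i x G0, ∐ U_ij x G1.   *)
Definition Idx (U : ocover X) : topologicalType := discrete_topology {classic (cidx U)}.

Definition Pc (U : ocover X) (c : cocycle G U) : space2 G X :=
  @Space2 G X ((Idx U * X) * G0 G)%type (((Idx U * Idx U) * X) * G1 G)%type
    [set o | cset U o.1.1 o.1.2]
    [set m | cset U m.1.1.1 m.1.2 /\ cset U m.1.1.2 m.1.2]
    (fun m => ((m.1.1.1, m.1.2), src m.2))
    (fun m => ((m.1.1.2, m.1.2), mul0 (inv0 (cx c m.1.1.1 m.1.1.2 m.1.2)) (tgt m.2)))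
    (fun m n => (((m.1.1.1, n.1.1.2), m.1.2),
                 mul1 (ce c m.1.1.1 m.1.1.2 n.1.1.2 m.1.2)
                      (cmp m.2 (mul1 (idn (cx c m.1.1.1 m.1.1.2 m.1.2)) n.2))))
    (fun o y => (o.1, mul0 o.2 y))
    (fun m h => (m.1, mul1 m.2 h))
    (fun o => o.1.2).

End Cech.

Definition contractible (X : topologicalType) (A : set X) : Prop :=
  exists x0, A x0 /\
  exists H : X * Rdefinitions.R -> X,
    {within A `*` [set t : Rdefinitions.R | (0 <= t <= 1)%R], continuous H} /\
    (forall a t, A a -> (0 <= t <= 1)%R -> A (H (a, t))) /\
    (forall a, A a -> H (a, 0%R) = a /\ H (a, 1%R) = x0).

Definition admits_good_covers (X : topologicalType) : Prop :=
  forall U : ocover X, exists V : ocover X,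
    (forall j, exists i, cset V j `<=` cset U i) /\
    (forall l : seq (cidx V), l <> [::] ->
       let W := [set x | forall k, List.In k l -> cset V k x] in
       W !=set0 -> contractible W).

(* Main.v *)
(* Call a cocycle c = (x, e) presented by a bundle P when P has local
   sections s_i and morphisms h_ij : s_i x_ij -> s_j such that (h_ij . x_jk)
   * h_jk and h_ik differ by the 2-cell e_ijk acting on s_i. In a
   trivializing chart any two sections are linked by some h, and a morphism
   s x -> s y is the action on s of a unique 2-cell x -> y; so every
   principal bundle presents a cocycle, and the cocycle identity is the
   associativity of P. A presentation of c amounts to a morphism P_c -> P
   (whence surjectivity), and bundle morphisms carry presentations forward.
   Two cocycles presented by the same bundle are identified in the colimit:
   on a common refinement the union of the two families of sections again
   presents a cocycle, which restricts to both. As P_c presents c,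
   injectivity follows. *)
Require Import Defs.
From Stdlib Require Import Relations.
From mathcomp Require Import all_boot all_classical topology.
Import Defs.

Set Implicit Arguments.
Unset Strict Implicit.
Unset Printing Implicit Defensive.

Local Open Scope classical_set_scope.

(** No cohomology between two presented cocycles is ever computed. A refinement of covers may use
    any map of index sets, so a cover whose members are all listed twice restricts to the original
    cover in two ways, and the colimit identifies both restrictions of one cocycle. That these
    restrictions are the given cocycles rests on a rigidity: over a chart the action of 2-cells on a
    unit is full and faithful, so sections and links not only admit cells [e] but determine them on
    the overlaps. The single coboundary that occurs is the trivial one. Bundle morphisms carry
    presentations only forward; across a span a cocycle is therefore drawn from the apex and pushed
    down both legs. *)

Local Notation "x ⋅ y" := (mul1 x y) (at level 40, left associativity).
Local Notation "x ⋆ y" := (mul0 x y) (at level 40, left associativity).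

(** * Relative continuity *)

Section Within.
Variables (T : topologicalType) (A : set T).
Implicit Types S R Q : topologicalType.

Lemma within_comp S R (B : set S) (f : T -> S) (g : S -> R) :
  {within B, continuous g} -> {within A, continuous f} ->
  (forall x, A x -> B (f x)) -> {within A, continuous (fun x => g (f x))}.
Proof.
move=> /subspace_continuousP cg /subspace_continuousP cf AB.
apply/subspace_continuousP => x Ax.
apply: (@cvg_trans _ (g @ within B (nbhs (f x)))); last exact: cg (AB _ Ax).
move=> N /= gN; have := cf _ Ax _ gN; rewrite /= !nbhs_simpl /= /within /=.
by apply: filterS => y h Ay; exact: h (AB _ Ay).
Qed.

Lemma within_cont_comp S R (f : T -> S) (g : S -> R) :
  continuous g -> {within A, continuous f} ->
  {within A, continuous (fun x => g (f x))}.
Proof.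
by move=> cg cf; apply: (@within_comp _ _ setT) cf _ => //; exact: continuous_subspaceT.
Qed.

Lemma within_sub S (B : set T) (f : T -> S) :
  {within B, continuous f} -> A `<=` B -> {within A, continuous f}.
Proof. by move=> cf AB; apply: continuous_subspaceW cf. Qed.

Lemma within_pair S R (f : T -> S) (g : T -> R) :
  {within A, continuous f} -> {within A, continuous g} ->
  {within A, continuous (fun x => (f x, g x))}.
Proof.
move=> /subspace_continuousP cf /subspace_continuousP cg.
by apply/subspace_continuousP => x Ax; apply: cvg_pair; [exact: cf|exact: cg].
Qed.

Lemma within_comp2 S R Q (B : set (S * R)) (f : T -> S) (h : T -> R)
    (g : S -> R -> Q) :
  {within B, continuous (fun p => g p.1 p.2)} ->
  {within A, continuous f} -> {within A, continuous h} ->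
  (forall x, A x -> B (f x, h x)) -> {within A, continuous (fun x => g (f x) (h x))}.
Proof.
move=> cg cf ch AB.
exact: (within_comp (f := fun x => (f x, h x)) cg (within_pair cf ch) AB).
Qed.

Lemma within_id : {within A, continuous (fun x => x)}.
Proof. by apply: continuous_subspaceT => x; exact: cvg_id. Qed.

Lemma within_cst S (s : S) : {within A, continuous (fun=> s)}.
Proof. by apply: continuous_subspaceT => x; exact: cvg_cst. Qed.

Lemma within_fst S R (f : T -> S * R) :
  {within A, continuous f} -> {within A, continuous (fun x => (f x).1)}.
Proof. by apply: within_cont_comp => p; exact: cvg_fst. Qed.

Lemma within_snd S R (f : T -> S * R) :
  {within A, continuous f} -> {within A, continuous (fun x => (f x).2)}.
Proof. by apply: within_cont_comp => p; exact: cvg_snd. Qed.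

(** Points of [D] are open, so [k] is constant near each point and only one member of the family [f]
    matters there. This gives continuity on the coproducts that make up [Pc]. *)
Lemma within_discrete (D : discreteTopologicalType) S (k : T -> D)
    (f : D -> T -> S) :
  {within A, continuous k} ->
  (forall i, {within [set x | A x /\ k x = i], continuous (f i)}) ->
  {within A, continuous (fun x => f (k x) x)}.
Proof.
move=> /subspace_continuousP ck cf; apply/subspace_continuousP => x Ax N fN.
have := cf (k x); move=> /subspace_continuousP /(_ x (Logic.conj Ax erefl) _ fN).
have := ck x Ax _ (discrete_set1 (k x)).
rewrite /= !nbhs_simpl /= /within /= => h1 h2.
apply: filterS2 h1 h2 => y h1 h2 Ay; have kE : k y = k x := h1 Ay.
by rewrite /from_subspace kE; exact: h2.
Qed.

End Within.

(** * Algebra in a topological 2-group *)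

Section TwoGroup.
Variable G : twoGroup.
Implicit Types (x y : G0 G) (g h k e w : G1 G).

Lemma mul1K g h : g ⋅ h ⋅ inv1 h = g.
Proof. by rewrite -mul1A mul1xV mul1x1. Qed.
Lemma mul1VK g h : g ⋅ inv1 h ⋅ h = g.
Proof. by rewrite -mul1A mul1Vx mul1x1. Qed.
Lemma mul1I g h k : g ⋅ h = g ⋅ k -> h = k.
Proof. by move/(congr1 (mul1 (inv1 g))); rewrite !mul1A mul1Vx !mul11x. Qed.
Lemma mul1Ir g h k : h ⋅ g = k ⋅ g -> h = k.
Proof. by move/(congr1 (mul1^~ (inv1 g))); rewrite !mul1K. Qed.
Lemma inv1M g h : inv1 (g ⋅ h) = inv1 h ⋅ inv1 g.
Proof. by apply: (@mul1I (g ⋅ h)); rewrite mul1xV mul1A mul1K mul1xV. Qed.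
Lemma inv1K g : inv1 (inv1 g) = g.
Proof. by apply: (@mul1I (inv1 g)); rewrite mul1xV mul1Vx. Qed.
Lemma inv11 : inv1 one1 = one1 :> G1 G.
Proof. by rewrite -[LHS]mul1x1 mul1Vx. Qed.

Lemma mul0K x y : x ⋆ y ⋆ inv0 y = x.
Proof. by rewrite -mul0A mul0xV mul0x1. Qed.
Lemma mul0VK x y : x ⋆ inv0 y ⋆ y = x.
Proof. by rewrite -mul0A mul0Vx mul0x1. Qed.
Lemma mul0I z x y : z ⋆ x = z ⋆ y -> x = y.
Proof. by move/(congr1 (mul0 (inv0 z))); rewrite !mul0A mul0Vx !mul01x. Qed.
Lemma inv0M x y : inv0 (x ⋆ y) = inv0 y ⋆ inv0 x.
Proof. by apply: (@mul0I (x ⋆ y)); rewrite mul0xV mul0A mul0K mul0xV. Qed.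
Lemma inv0K x : inv0 (inv0 x) = x.
Proof. by apply: (@mul0I (inv0 x)); rewrite mul0xV mul0Vx. Qed.
Lemma inv01 : inv0 one0 = one0 :> G0 G.
Proof. by rewrite -[LHS]mul0x1 mul0Vx. Qed.

Lemma idn1 : idn one0 = one1 :> G1 G. Proof. by rewrite one1E. Qed.
Lemma src1 : src one1 = one0 :> G0 G. Proof. by rewrite one1E src_idn. Qed.
Lemma tgt1 : tgt one1 = one0 :> G0 G. Proof. by rewrite one1E tgt_idn. Qed.

Definition grp0E := (mul0A, mul01x, mul0x1, mul0Vx, mul0xV, mul0K, mul0VK,
  inv0M, inv0K, inv01).
Definition grp1E := (mul1A, mul11x, mul1x1, mul1Vx, mul1xV, mul1K, mul1VK,
  inv1M, inv1K, inv11).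
Definition twoE := (src_mul, tgt_mul, src_inv, tgt_inv, src_idn, tgt_idn,
  idn_mul, idn_inv, idn1, src1, tgt1).

(** Composition is determined by multiplication: write g as 1 g and h as k 1_{t(g)} with k in
    Ker(s), and interchange splits the composite into k g. Placing the trivial factor on the other
    side gives [cmpE']. *)
Lemma cmpE g h : tgt g = src h -> cmp g h = h ⋅ inv1 (idn (tgt g)) ⋅ g.
Proof.
move=> gh; set k := h ⋅ inv1 (idn (tgt g)).
have sk : src k = one0 by rewrite !twoE -gh !grp0E.
have {1}-> : g = one1 ⋅ g by rewrite mul11x.
have -> : h = k ⋅ idn (tgt g) by rewrite mul1VK.
by rewrite -interchange ?tgt1 ?src_idn // cmp_idr one1E -sk cmp_idl.
Qed.

Lemma cmpE' g h : tgt g = src h -> cmp g h = g ⋅ inv1 (idn (tgt g)) ⋅ h.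
Proof.
move=> gh; set k := inv1 (idn (tgt g)) ⋅ h.
have sk : src k = one0 by rewrite !twoE -gh !grp0E.
have {1}-> : g = g ⋅ one1 by rewrite mul1x1.
have -> : h = idn (tgt g) ⋅ k by rewrite /k !grp1E.
by rewrite -interchange ?tgt1 ?src_idn // cmp_idr one1E -sk cmp_idl /k !grp1E.
Qed.

(** The Peiffer identity of the crossed module Ker(s) → G0, read off by comparing the two product
    formulas for the composite of e and 1_{t(e)} w. *)
Lemma peiffer e w : src e = one0 -> src w = one0 ->
  idn (tgt e) ⋅ w ⋅ inv1 (idn (tgt e)) = e ⋅ w ⋅ inv1 e.
Proof.
move=> se sw; apply: (@mul1Ir e); rewrite mul1VK.
have te : tgt e = src (idn (tgt e) ⋅ w) by rewrite !twoE sw mul0x1.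
by rewrite -cmpE // cmpE' // !grp1E.
Qed.

Lemma cmp_idempotent g : src g = tgt g -> cmp g g = g -> g = idn (src g).
Proof.
move=> st; rewrite cmpE // => /(congr1 (mul1^~ (inv1 g))); rewrite mul1K mul1xV => h.
by apply: (@mul1Ir (inv1 (idn (tgt g)))); rewrite h st mul1xV.
Qed.

End TwoGroup.

(** * 2-spaces and charts *)

Section Hom.
Variables (G : twoGroup) (X : topologicalType).

Definition hom (P : space2 G X) (p q : ob P) (f : mor P) :=
  [/\ morS f, sP f = p & tP f = q].

(** Identities are encoded as idempotent endomorphisms: a 2-space provides its units only
    existentially, and idempotency passes along functors that are merely assumed to preserve
    composition. *)
Definition unit_at (P : space2 G X) (p : ob P) (m : mor P) :=
  hom p p m /\ cP m m = m.

Variables (P : space2 G X) (HP : is_2space P).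
Implicit Types (p q r : ob P) (f h k m : mor P) (x y : G0 G) (g : G1 G).

Lemma hom_composable p q r f h : hom p q f -> hom q r h -> composable f h.
Proof. by move=> [? _ t] [? s _]; split=> //; split=> //; rewrite t s. Qed.

Lemma hom_obl p q f : hom p q f -> obS p.
Proof. by case=> fS <- _; exact: sP_in. Qed.

Lemma hom_cP p q r f h : hom p q f -> hom q r h -> hom p r (cP f h).
Proof.
move=> fpq hqr; have fh := hom_composable fpq hqr.
split; first exact: cP_in.
- by rewrite sP_cP //; case: fpq.
- by rewrite tP_cP //; case: hqr.
Qed.

Lemma hom_act p q f g x y : hom p q f -> src g = x -> tgt g = y ->
  hom (act0 p x) (act0 q y) (act1 f g).
Proof.
move=> [fS <- <-] <- <-; split; first exact: act1_in.
- exact: sP_act.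
- exact: tP_act.
Qed.

Lemma hom_act_idn p q f x : hom p q f -> hom (act0 p x) (act0 q x) (act1 f (idn x)).
Proof. by move=> fpq; apply: hom_act fpq _ _; rewrite ?src_idn ?tgt_idn. Qed.

Lemma hom_cPA p q r s f h k : hom p q f -> hom q r h -> hom r s k ->
  cP f (cP h k) = cP (cP f h) k.
Proof. by move=> a b c; apply: cPA => //; [exact: hom_composable a b|exact: hom_composable b c]. Qed.

Lemma hom_cmp p q r f h g g' : hom p q f -> hom q r h -> tgt g = src g' ->
  act1 (cP f h) (cmp g g') = cP (act1 f g) (act1 h g').
Proof. by move=> a b; apply: act_cP => //; exact: hom_composable a b. Qed.

Lemma unit_atE : exists e : ob P -> mor P, {within obS, continuous e} /\
  forall p, obS p -> unit_at p (e p) /\ (forall m, unit_at p m -> m = e p).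
Proof.
case: (units_inverses HP) => e [iv [He [Hid [Hiv [ce _]]]]].
exists e; split=> // p pS; have [eS [se te]] := He _ pS; split.
  split; first by split.
  by have [] := Hid _ eS; rewrite se.
move=> m [[mS sm tm] mm]; have [iS [si [ti [mi _]]]] := Hiv _ mS.
have hm : hom p p m by split.
have hi : hom p p (iv m) by split=> //; rewrite ?si ?ti.
have := hom_cPA hm hm hi; rewrite mm mi sm.
by have [_] := Hid _ mS; rewrite tm => ->.
Qed.

Lemma unit_at_uniq p m m' : unit_at p m -> unit_at p m' -> m = m'.
Proof.
move=> um um'; case: unit_atE => e [_ He].
by have [_ h] := He _ (hom_obl um.1); rewrite (h _ um) (h _ um').
Qed.

Lemma unit_at_cPl p q m f : unit_at p m -> hom p q f -> cP m f = f.
Proof.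
case: (units_inverses HP) => e [iv [He [Hid _]]] um [fS sf tf].
have [eS [se te]] := He _ (hom_obl um.1).
have ue : unit_at p (e p) by split; [by split|by have [] := Hid _ eS; rewrite se].
by rewrite (unit_at_uniq um ue); have [] := Hid _ fS; rewrite sf.
Qed.

Lemma unit_at_cPr p q m f : unit_at q m -> hom p q f -> cP f m = f.
Proof.
case: (units_inverses HP) => e [iv [He [Hid _]]] um [fS sf tf].
have [eS [se te]] := He _ (hom_obl um.1).
have ue : unit_at q (e q) by split; [by split|by have [] := Hid _ eS; rewrite se].
by rewrite (unit_at_uniq um ue); have [_] := Hid _ fS; rewrite tf.
Qed.

Lemma inverse_ex : exists iv : mor P -> mor P, {within morS, continuous iv} /\
  forall p q f, hom p q f ->
    [/\ hom q p (iv f), unit_at p (cP f (iv f)) & unit_at q (cP (iv f) f)].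
Proof.
case: (units_inverses HP) => e [iv [He [Hid [Hiv [_ civ]]]]].
exists iv; split=> // p q f [fS sf tf].
have [iS [si [ti [fi ifE]]]] := Hiv _ fS.
have ue r : obS r -> unit_at r (e r).
  by move=> /He[eS [se te]]; split; [by split|by have [] := Hid _ eS; rewrite se].
rewrite fi ifE sf tf; split.
- by split=> //; rewrite ?si ?ti.
- by apply: ue; rewrite -sf; exact: sP_in.
- by apply: ue; rewrite -tf; exact: tP_in.
Qed.

Lemma cP_cancell p q r f h k : hom p q f -> hom q r h -> hom q r k ->
  cP f h = cP f k -> h = k.
Proof.
case: inverse_ex => iv [_ Hiv] hf hh hk E.
have [hi _ u] := Hiv _ _ _ hf.
rewrite -(unit_at_cPl u hh) -(unit_at_cPl u hk).
by rewrite -(hom_cPA hi hf hh) -(hom_cPA hi hf hk) E.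
Qed.

Lemma cP_cancelr p q r f h k : hom q r f -> hom p q h -> hom p q k ->
  cP h f = cP k f -> h = k.
Proof.
case: inverse_ex => iv [_ Hiv] hf hh hk E.
have [hi u _] := Hiv _ _ _ hf.
rewrite -(unit_at_cPr u hh) -(unit_at_cPr u hk).
by rewrite (hom_cPA hh hf hi) (hom_cPA hk hf hi) E.
Qed.

Lemma act_cP_idn p q r f h x : hom p q f -> hom q r h ->
  act1 (cP f h) (idn x) = cP (act1 f (idn x)) (act1 h (idn x)).
Proof.
move=> a b; rewrite -(hom_cmp a b) ?src_idn ?tgt_idn //.
by congr act1; have := cmp_idr (idn x); rewrite tgt_idn.
Qed.

Lemma unit_at_act p m x : unit_at p m -> unit_at (act0 p x) (act1 m (idn x)).
Proof.
move=> [hm mm]; split; first exact: hom_act_idn.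
by rewrite -(act_cP_idn _ hm hm) mm.
Qed.

Lemma act_unit_cmp p m g g' : unit_at p m -> tgt g = src g' ->
  cP (act1 m g) (act1 m g') = act1 m (cmp g g').
Proof. by move=> um gg; rewrite -(hom_cmp um.1 um.1) // um.2. Qed.

(** Functoriality of the action applied to f = 1_p * f and g = g * 1_{t(g)}. Together with
    [act_splitr] it lets a 2-cell slide from the source of f to its target. *)
Lemma act_splitl p q m f g : unit_at p m -> hom p q f ->
  act1 f g = cP (act1 m g) (act1 f (idn (tgt g))).
Proof.
move=> um hf; rewrite -(hom_cmp um.1 hf) ?src_idn // cmp_idr.
by rewrite (unit_at_cPl um hf).
Qed.

Lemma act_splitr p q m f g : unit_at q m -> hom p q f ->
  act1 f g = cP (act1 f (idn (src g))) (act1 m g).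
Proof.
move=> um hf; rewrite -(hom_cmp hf um.1) ?tgt_idn // cmp_idl.
by rewrite (unit_at_cPr um hf).
Qed.

Lemma act0_split p x y : obS p -> act0 p (x ⋆ y) = act0 (act0 p x) y.
Proof. by move=> pS; rewrite act0_mul. Qed.

Lemma act1_split p q f g g' : hom p q f -> act1 f (g ⋅ g') = act1 (act1 f g) g'.
Proof. by case=> fS _ _; rewrite act1_mul. Qed.

(* The action is only assumed to preserve the fibres of [proj] on the standard
   bundle; the isomorphism [eta] carries this over to [P]. *)
Lemma chart_proj_act (T : set X) p x : chart P T -> obS p -> T (proj p) ->
  proj (act0 p x) = proj p.
Proof.
move=> [phi0 [phi1 [psi0 [psi1 [eta [_ [_ [_ [_ [_ [_ [_ [psi0_in [_ [_ [psi0M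
  [_ [_ [_ [eta_in [_ [etaM _]]]]]]]]]]]]]]]]]]]]]] pS Tp.
have [eS [es et]] := eta_in _ (Logic.conj pS Tp).
have := proj_functor HP (act1_in HP (idn x) eS).
rewrite sP_act // tP_act // src_idn tgt_idn et es -psi0M // => <-.
by have [] := psi0_in _ (phi0 p ⋆ x) Tp.
Qed.

Lemma chart_section (T : set X) : chart P T -> exists s : X -> ob P,
  {within T, continuous s} /\ forall u, T u -> obS (s u) /\ proj (s u) = u.
Proof.
move=> [phi0 [phi1 [psi0 [psi1 [eta [_ [_ [_ [_ [_ [_ [_ [psi0_in [_ [_ [_
  [_ [psi0_cont _]]]]]]]]]]]]]]]]]].
exists (psi0^~ one0); split; last by move=> u; exact: psi0_in.
exact: (within_comp2 psi0_cont (@within_id _ _) (@within_cst _ _ _ one0)).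
Qed.

Lemma within_cP (T : topologicalType) (A : set T) (f h : T -> mor P) :
  {within A, continuous f} -> {within A, continuous h} ->
  (forall t, A t -> composable (f t) (h t)) ->
  {within A, continuous (fun t => cP (f t) (h t))}.
Proof. by move=> cf ch fh; exact: (within_comp2 (cP_cont HP)). Qed.

Lemma within_act0 (T : topologicalType) (A : set T) (f : T -> ob P) (x : T -> G0 G) :
  {within A, continuous f} -> {within A, continuous x} ->
  (forall t, A t -> obS (f t)) ->
  {within A, continuous (fun t => act0 (f t) (x t))}.
Proof. by move=> cf ch fh; exact: (within_comp2 (act0_cont HP)). Qed.

Lemma within_act1 (T : topologicalType) (A : set T) (f : T -> mor P) (g : T -> G1 G) :
  {within A, continuous f} -> {within A, continuous g} ->
  (forall t, A t -> morS (f t)) ->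
  {within A, continuous (fun t => act1 (f t) (g t))}.
Proof. by move=> cf ch fh; exact: (within_comp2 (act1_cont HP)). Qed.

Lemma within_idn (T : topologicalType) (A : set T) (x : T -> G0 G) :
  {within A, continuous x} -> {within A, continuous (fun t => idn (x t))}.
Proof. by apply: within_cont_comp; exact: idn_cont. Qed.

Lemma within_inv0 (T : topologicalType) (A : set T) (x : T -> G0 G) :
  {within A, continuous x} -> {within A, continuous (fun t => inv0 (x t))}.
Proof. by apply: within_cont_comp; exact: inv0_cont. Qed.

Lemma within_inv1 (T : topologicalType) (A : set T) (x : T -> G1 G) :
  {within A, continuous x} -> {within A, continuous (fun t => inv1 (x t))}.
Proof. by apply: within_cont_comp; exact: inv1_cont. Qed.

Lemma within_src (T : topologicalType) (A : set T) (x : T -> G1 G) :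
  {within A, continuous x} -> {within A, continuous (fun t => src (x t))}.
Proof. by apply: within_cont_comp; exact: src_cont. Qed.

Lemma within_tgt (T : topologicalType) (A : set T) (x : T -> G1 G) :
  {within A, continuous x} -> {within A, continuous (fun t => tgt (x t))}.
Proof. by apply: within_cont_comp; exact: tgt_cont. Qed.

Lemma within_mul0 (T : topologicalType) (A : set T) (x y : T -> G0 G) :
  {within A, continuous x} -> {within A, continuous y} ->
  {within A, continuous (fun t => x t ⋆ y t)}.
Proof.
move=> cx cy; apply: (within_cont_comp (@mul0_cont G)) (within_pair cx cy).
Qed.

Lemma within_mul1 (T : topologicalType) (A : set T) (x y : T -> G1 G) :
  {within A, continuous x} -> {within A, continuous y} ->
  {within A, continuous (fun t => x t ⋅ y t)}.
Proof.
move=> cx cy; apply: (within_cont_comp (@mul1_cont G)) (within_pair cx cy).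
Qed.

(** With x = phi0(s)^{-1} phi0(s'), both s x and s' receive a morphism from psi0(u, phi0(s')): [eta]
    at s acted on by 1_x, and [eta] at s'. The link is the inverse of the first followed by the
    second. *)
Lemma chart_connect (T A : set X) (s s' : X -> ob P) :
  chart P T -> A `<=` T ->
  {within A, continuous s} -> {within A, continuous s'} ->
  (forall u, A u -> obS (s u) /\ proj (s u) = u) ->
  (forall u, A u -> obS (s' u) /\ proj (s' u) = u) ->
  exists (x : X -> G0 G) (h : X -> mor P),
    [/\ {within A, continuous x}, {within A, continuous h} &
        forall u, A u -> hom (act0 (s u) (x u)) (s' u) (h u)].
Proof.
move=> [phi0 [phi1 [psi0 [psi1 [eta [_ [_ [_ [_ [_ [phi0_cont [_ [psi0_in [_ [_ [psi0M
  [_ [_ [_ [eta_in [_ [etaM [eta_cont _]]]]]]]]]]]]]]]]]]]]]]] AT cs cs' Hs Hs'.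
case: inverse_ex => iv [civ Hiv].
have sT u : A u -> obS (s u) /\ T (proj (s u)).
  by move=> Au; have [sS ->] := Hs _ Au; split=> //; exact: AT.
have s'T u : A u -> obS (s' u) /\ T (proj (s' u)).
  by move=> Au; have [sS ->] := Hs' _ Au; split=> //; exact: AT.
pose x u := inv0 (phi0 (s u)) ⋆ phi0 (s' u).
have cx : {within A, continuous x}.
  by apply: within_mul0; [apply: within_inv0|]; exact: within_comp phi0_cont _ _.
have H u : A u -> hom (psi0 u (phi0 (s' u))) (act0 (s u) (x u)) (act1 (eta (s u)) (idn (x u))).
  move=> Au; have [eS [es et]] := eta_in _ (sT _ Au).
  have -> : phi0 (s' u) = phi0 (s u) ⋆ x u by rewrite /x !grp0E.
  rewrite psi0M; last exact: AT.
  by apply: hom_act_idn; split=> //; rewrite es (Hs _ Au).2.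
have H' u : A u -> hom (psi0 u (phi0 (s' u))) (s' u) (eta (s' u)).
  by move=> Au; have [eS [es et]] := eta_in _ (s'T _ Au); split=> //; rewrite es (Hs' _ Au).2.
exists x, (fun u => cP (iv (act1 (eta (s u)) (idn (x u)))) (eta (s' u))); split=> //.
- apply: within_cP.
  + apply: within_comp civ _ _; last by move=> u /H[].
    apply: within_act1; last by move=> u /sT/eta_in[].
      exact: within_comp eta_cont _ _.
    exact: within_idn.
  + exact: within_comp eta_cont _ _.
  + by move=> u Au; have [hi _ _] := Hiv _ _ _ (H _ Au); exact: hom_composable hi (H' _ Au).
- by move=> u Au; have [hi _ _] := Hiv _ _ _ (H _ Au); exact: hom_cP hi (H' _ Au).
Qed.

Lemma chart_faithful (T : set X) p o g g' : chart P T -> T (proj p) -> unit_at p o ->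
  act1 o g = act1 o g' -> g = g'.
Proof.
move=> [phi0 [phi1 [psi0 [psi1 [_ [_ [_ [_ [_ [phi1M _]]]]]]]]]] Tp [[oS so to] _].
have oT : morS o /\ T (proj (sP o)) by rewrite so.
by move=> /(congr1 phi1); rewrite !phi1M //; exact: mul1I.
Qed.

(** Equivariance of [phi1] forces g = phi1(o)^{-1} phi1(k). Then o g and k have the same image under
    [phi1], and naturality of [eta], whose components can be cancelled, makes them equal. *)
Lemma chart_full (T A : set X) (s : X -> ob P) (o k : X -> mor P) (x y : X -> G0 G) :
  chart P T -> A `<=` T -> {within A, continuous s} ->
  {within A, continuous x} -> {within A, continuous y} -> {within A, continuous k} ->
  (forall u, A u -> proj (s u) = u) ->
  (forall u, A u -> unit_at (s u) (o u)) ->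
  (forall u, A u -> hom (act0 (s u) (x u)) (act0 (s u) (y u)) (k u)) ->
  exists g : X -> G1 G, {within A, continuous g} /\
    forall u, A u -> [/\ src (g u) = x u, tgt (g u) = y u & act1 (o u) (g u) = k u].
Proof.
move=> chT AT cs cx cy ck Hs Ho Hk; have := chT.
move=> [phi0 [phi1 [psi0 [psi1 [eta [_ [phi1_hom [phi1_cP [phi0M [phi1M
  [phi0_cont [phi1_cont [_ [psi1_in [_ [_ [_ [_ [_ [eta_in [eta_nat _
  ]]]]]]]]]]]]]]]]]]]]].
have sS u : A u -> obS (s u) by move=> /Ho[/hom_obl].
have sT u : A u -> obS (s u) /\ T (proj (s u)).
  by move=> Au; split; [exact: sS|rewrite Hs //; exact: AT].
have pE u z : A u -> proj (act0 (s u) z) = u.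
  by move=> Au; rewrite (chart_proj_act z chT (sT _ Au).1 (sT _ Au).2); exact: Hs.
have kT u : A u -> morS (k u) /\ T (proj (sP (k u))).
  by move=> Au; have [kS -> _] := Hk _ Au; split=> //; rewrite pE //; exact: AT.
pose g u := inv1 (idn (phi0 (s u))) ⋅ phi1 (k u).
(* The image of a unit is idempotent, hence an identity of the 2-group. *)
have oE u : A u -> phi1 (o u) = idn (phi0 (s u)).
  move=> Au; have [[oS so to] oo] := Ho _ Au.
  have oT : morS (o u) /\ T (proj (sP (o u))) by rewrite so; split=> //; exact: (sT _ Au).2.
  have [e1 e2] := phi1_hom _ oT.
  rewrite -so -e1; apply: cmp_idempotent; first by rewrite e1 e2 so to.
  rewrite -phi1_cP; [by rewrite oo|exact: hom_composable (Ho _ Au).1 (Ho _ Au).1|exact: oT.2].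
have gst u : A u -> src (g u) = x u /\ tgt (g u) = y u.
  move=> Au; have [e1 e2] := phi1_hom _ (kT _ Au); have [_ sk tk] := Hk _ Au.
  by rewrite !twoE e1 e2 sk tk !phi0M ?grp0E //; exact: sT.
exists g; split.
  apply: within_mul1; first by apply/within_inv1/within_idn; exact: within_comp phi0_cont _ _.
  exact: within_comp phi1_cont _ _.
move=> u Au; have [sg tg] := gst _ Au; split=> //.
have ho : hom (act0 (s u) (x u)) (act0 (s u) (y u)) (act1 (o u) (g u)).
  by apply: hom_act => //; exact: (Ho _ Au).1.
have phiE : phi1 (act1 (o u) (g u)) = phi1 (k u).
  have [[oS so to] _] := Ho _ Au.
  rewrite phi1M; last by split=> //; rewrite so; exact: (sT _ Au).2.
  by rewrite oE // !grp1E.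
have e_in z : A u -> hom (psi0 u (phi0 (act0 (s u) z))) (act0 (s u) z) (eta (act0 (s u) z)).
  move=> _; have [] : morS (eta (act0 (s u) z)) /\ sP (eta (act0 (s u) z)) = psi0 u (phi0 (act0 (s u) z))
      /\ tP (eta (act0 (s u) z)) = act0 (s u) z.
    have := eta_in (act0 (s u) z); rewrite /= pE //; apply; split; last exact: AT.
    by apply: act0_in => //; exact: sS.
  by move=> eS [es et]; split.
apply: (cP_cancell (e_in _ Au) ho (Hk _ Au)).
have [kS sk tk] := Hk _ Au; have [oS so to] := ho.
have := eta_nat _ (kT _ Au); rewrite sk tk pE // => ->.
have := eta_nat (act1 (o u) (g u)); rewrite /= so to pE // phiE; apply.
by split=> //; exact: AT.
Qed.

End Hom.

(** * Cocycles presented by local sections *)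

Section Frames.
Variables (G : twoGroup) (X : topologicalType).

(** Units [o] are part of the data so that later equations can refer to a fixed, continuous choice.
    The cells [e] are left out because the other data determine them over charts. *)
Record frame (P : space2 G X) (U : ocover X) (x : cidx U -> cidx U -> X -> G0 G)
    (s : cidx U -> X -> ob P) (o : cidx U -> X -> mor P)
    (h : cidx U -> cidx U -> X -> mor P) : Prop := {
  frame_sec : forall i u, cset U i u -> obS (s i u) /\ proj (s i u) = u;
  frame_unit : forall i u, cset U i u -> unit_at (s i u) (o i u);
  frame_hom : forall i j u, cset U i u -> cset U j u ->
    hom (act0 (s i u) (x i j u)) (s j u) (h i j u);
  frame_sec_cont : forall i, {within cset U i, continuous (s i)};
  frame_unit_cont : forall i, {within cset U i, continuous (o i)};
  frame_cx_cont : forall i j, {within cset U i `&` cset U j, continuous (x i j)};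
  frame_hom_cont : forall i j, {within cset U i `&` cset U j, continuous (h i j)} }.

Global Arguments frame_sec_cont [P U x s o h] _ i.
Global Arguments frame_unit_cont [P U x s o h] _ i.
Global Arguments frame_cx_cont [P U x s o h] _ i j.
Global Arguments frame_hom_cont [P U x s o h] _ i j.

(* The 2-cells [e] measure the failure of the links [h] to compose strictly. *)
Definition coherent (P : space2 G X) (U : ocover X) (x : cidx U -> cidx U -> X -> G0 G)
    (e : cidx U -> cidx U -> cidx U -> X -> G1 G)
    (o : cidx U -> X -> mor P) (h : cidx U -> cidx U -> X -> mor P) :=
  forall i j k u, cset U i u -> cset U j u -> cset U k u ->
    cP (act1 (h i j u) (idn (x j k u))) (h j k u)
    = cP (act1 (o i u) (e i j k u ⋅ idn (x i j u) ⋅ idn (x j k u))) (h i k u).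

Definition presents (P : space2 G X) (U : ocover X) (c : cocycle G U) :=
  is_cocycle c /\ exists s o h,
    frame (P := P) (cx c) s o h /\ coherent (cx c) (ce c) o h.

Section TwoSpace.
Variables (P : space2 G X) (HP : is_2space P).

(* [e_ijk] has source [1] and target [x_ik (x_ij x_jk)^-1], so the 2-cell acting
   on [s_i] goes from [s_i x_ij x_jk] to [s_i x_ik]. *)
Lemma hom_cell (p : ob P) (m : mor P) (e : G1 G) (x y z : G0 G) : unit_at p m ->
  src e = one0 -> tgt e ⋆ x ⋆ y = z ->
  hom (act0 (act0 p x) y) (act0 p z) (act1 m (e ⋅ idn x ⋅ idn y)).
Proof.
move=> um se te; rewrite -(act0_split HP _ _ (hom_obl HP um.1)).
by apply: (hom_act HP um.1); rewrite !twoE // se !grp0E.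
Qed.

(** Cancelling the invertible link h_ik leaves two 2-cells acting equally on the unit at s_i, and
    that action is faithful over the chart. *)
Lemma coherent_uniq (U : ocover X) x e e' s o h :
  frame (P := P) (U := U) x s o h ->
  (forall i, exists2 T, chart P T & cset U i `<=` T) ->
  is_cocycle (Cocycle x e) -> is_cocycle (Cocycle x e') ->
  coherent x e o h -> coherent x e' o h ->
  forall i j k u, cset U i u -> cset U j u -> cset U k u -> e i j k u = e' i j k u.
Proof.
move=> F UT [_ [_ [e1 _]]] [_ [_ [e'1 _]]] ce ce' i j k u Ui Uj Uk.
have [T chT UiT] := UT i.
have [/= se te] := e1 _ _ _ _ Ui Uj Uk; have [/= se' te'] := e'1 _ _ _ _ Ui Uj Uk.
have uo := frame_unit F Ui.
apply: (@mul1Ir _ (idn (x i j u))); apply: (@mul1Ir _ (idn (x j k u))).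
apply: (chart_faithful chT _ uo).
  by rewrite (frame_sec F Ui).2; exact: UiT.
apply: (cP_cancelr HP (frame_hom F Ui Uk) (hom_cell uo se te) (hom_cell uo se' te')).
by rewrite -ce // -ce'.
Qed.

Lemma frame_cocycle (U : ocover X) x s o h :
  frame (P := P) (U := U) x s o h ->
  (forall i, exists2 T, chart P T & cset U i `<=` T) ->
  exists e, is_cocycle (Cocycle x e) /\ coherent x e o h.
Proof.
move=> F UT; case: (inverse_ex HP) => iv [civ Hiv].
have sS i u : cset U i u -> obS (s i u) by move=> /(frame_sec F)[].
have hx i j k u : cset U i u -> cset U j u -> cset U k u ->
    hom (act0 (act0 (s i u) (x i j u)) (x j k u)) (s k u)
        (cP (act1 (h i j u) (idn (x j k u))) (h j k u)).
  move=> Ui Uj Uk; apply: (hom_cP HP) (frame_hom F Uj Uk).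
  exact: hom_act_idn (frame_hom F Ui Uj).
have ex (p : cidx U * cidx U * cidx U) : exists g : X -> G1 G,
    let: (i, j, k) := p in
    {within cset U i `&` cset U j `&` cset U k, continuous g} /\
    forall u, cset U i u -> cset U j u -> cset U k u ->
      [/\ src (g u) = x i j u ⋆ x j k u, tgt (g u) = x i k u &
      cP (act1 (h i j u) (idn (x j k u))) (h j k u) = cP (act1 (o i u) (g u)) (h i k u)].
  move: p => [[i j] k]; have [T chT UiT] := UT i.
  set A := cset U i `&` cset U j `&` cset U k.
  have Aij : A `<=` cset U i `&` cset U j by move=> u [].
  have Ajk : A `<=` cset U j `&` cset U k by move=> u [[]].
  have Aik : A `<=` cset U i `&` cset U k by move=> u [[]].
  have AT : A `<=` T by move=> u [[/UiT]].
  (* Going from s_i to s_k through s_j and back along h_ik gives a morphism between translates of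
     s_i, which fullness turns into a 2-cell. *)
  pose kk u := cP (cP (act1 (h i j u) (idn (x j k u))) (h j k u)) (iv (h i k u)).
  have [] := @chart_full _ _ _ HP T A (s i) (o i) kk (fun u => x i j u ⋆ x j k u) (x i k) chT AT.
  - by apply: within_sub (frame_sec_cont F i) _ => u [[]].
  - by apply: within_mul0; [exact: within_sub (frame_cx_cont F _ _) Aij|
      exact: within_sub (frame_cx_cont F _ _) Ajk].
  - exact: within_sub (frame_cx_cont F _ _) Aik.
  - have h1 : {within A, continuous h i j} by exact: within_sub (frame_hom_cont F _ _) Aij.
    have h2 : {within A, continuous h j k} by exact: within_sub (frame_hom_cont F _ _) Ajk.
    have h3 : {within A, continuous h i k} by exact: within_sub (frame_hom_cont F _ _) Aik.
    apply: (within_cP HP); first apply: (within_cP HP) => //.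
    + apply: (within_act1 HP) => //; last by move=> u [[Ui Uj] _]; case: (frame_hom F Ui Uj).
      by apply: within_idn; exact: within_sub (frame_cx_cont F _ _) Ajk.
    + move=> u [[Ui Uj] Uk]; apply: (hom_composable _ (frame_hom F Uj Uk)).
      exact: hom_act_idn (frame_hom F Ui Uj).
    + by apply: within_comp civ h3 _ => u [[Ui _] Uk]; case: (frame_hom F Ui Uk).
    + move=> u [[Ui Uj] Uk]; have [hi _ _] := Hiv _ _ _ (frame_hom F Ui Uk).
      exact: hom_composable (hx _ _ _ _ Ui Uj Uk) hi.
  - by move=> u [[/(frame_sec F)[]]].
  - by move=> u [[/(frame_unit F)]].
  - move=> u [[Ui Uj] Uk]; have [hi _ _] := Hiv _ _ _ (frame_hom F Ui Uk).
    rewrite (act0_split HP _ _ (sS _ _ Ui)); exact: (hom_cP HP) (hx _ _ _ _ Ui Uj Uk) hi.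
  move=> g [cg Hg]; exists g; split=> // u Ui Uj Uk.
  have [sg tg ->] := Hg _ (Logic.conj (Logic.conj Ui Uj) Uk); split=> //.
  have [hi _ um] := Hiv _ _ _ (frame_hom F Ui Uk).
  have hh := hx _ _ _ _ Ui Uj Uk.
  by rewrite -(hom_cPA HP hh hi (frame_hom F Ui Uk)) (unit_at_cPr HP um hh).
have [E HE] := choice ex => {ex}.
(* The cell [E] runs from x_ij x_jk to x_ik; dividing by identities on the right moves its source to
   1, as membership in Ker(s) demands. *)
pose e i j k u := E (i, j, k) u ⋅ inv1 (idn (x j k u)) ⋅ inv1 (idn (x i j u)).
have Ee i j k u : E (i, j, k) u = e i j k u ⋅ idn (x i j u) ⋅ idn (x j k u).
  by rewrite /e !grp1E.
have est i j k u : cset U i u -> cset U j u -> cset U k u ->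
    src (e i j k u) = one0 /\ tgt (e i j k u) ⋆ x i j u ⋆ x j k u = x i k u.
  move=> Ui Uj Uk; have [_ /(_ _ Ui Uj Uk)[sE tE _]] := HE (i, j, k).
  by rewrite !twoE sE tE !grp0E.
have coh : coherent x e o h.
  move=> i j k u Ui Uj Uk; have [_ /(_ _ Ui Uj Uk)[_ _ ->]] := HE (i, j, k).
  by rewrite Ee.
have ec i j k : {within cset U i `&` cset U j `&` cset U k, continuous (e i j k)}.
  have [/= cE _] := HE (i, j, k).
  apply: within_mul1; [apply: within_mul1 => //|]; apply/within_inv1/within_idn.
    by apply: within_sub (frame_cx_cont F _ _) _ => u [[]].
  by apply: within_sub (frame_cx_cont F _ _) _ => u [[]].
clearbody e; clear E HE Ee.
exists e; split=> //; split; first exact: frame_cx_cont F.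
split; first exact: ec.
split=> [//|i j k l u Ui Uj Uk Ul /=].
have [T chT UiT] := UT i.
have ui := frame_unit F Ui; have uj := frame_unit F Uj.
have [sijk tijk] := est _ _ _ _ Ui Uj Uk.
have [sikl tikl] := est _ _ _ _ Ui Uk Ul.
have [sijl tijl] := est _ _ _ _ Ui Uj Ul.
have [sjkl tjkl] := est _ _ _ _ Uj Uk Ul.
have hij := frame_hom F Ui Uj; have hjk := frame_hom F Uj Uk.
have hkl := frame_hom F Uk Ul; have hik := frame_hom F Ui Uk.
have hjl := frame_hom F Uj Ul; have hil := frame_hom F Ui Ul.
set a := x i j u in tijk hij *; set b := x j k u in tijk tjkl hjk *.
set c := x k l u in tjkl hkl *; set d := x i k u in tijk tikl hik *.
set f := x j l u in tjkl hjl *; set y := x i l u in tijl tikl hil *.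
pose e1 := e i j k u ⋅ idn a ⋅ idn b; pose e2 := e i k l u ⋅ idn d ⋅ idn c.
pose e3 := e j k l u ⋅ idn b ⋅ idn c; pose e4 := e i j l u ⋅ idn a ⋅ idn f.
(* Both composite cells, followed by h_il, give the path from s_i x_ij x_jk x_kl to s_l through all
   the links, bracketed in two ways. Cancelling h_il and using faithfulness equates the cells. *)
have A : cmp (e1 ⋅ idn c) e2 = cmp (idn a ⋅ e3) e4.
  have t1 : tgt (e1 ⋅ idn c) = src e2 by rewrite /e1 /e2 /e3 /e4 !twoE tijk sikl !grp0E.
  have t2 : tgt (idn a ⋅ e3) = src e4 by rewrite /e1 /e2 /e3 /e4 !twoE -tjkl sijl !grp0E.
  have te2 : tgt e2 = y by rewrite /e1 /e2 /e3 /e4 !twoE tikl.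
  have te4 : tgt e4 = y by rewrite /e1 /e2 /e3 /e4 !twoE tijl.
  have se1 : src (e1 ⋅ idn c) = a ⋆ b ⋆ c by rewrite /e1 /e2 /e3 /e4 !twoE sijk !grp0E.
  have se3 : src (idn a ⋅ e3) = a ⋆ b ⋆ c by rewrite /e1 /e2 /e3 /e4 !twoE sjkl !grp0E.
  apply: (chart_faithful chT _ ui).
    by rewrite (frame_sec F Ui).2; exact: UiT.
  have H1 : hom (act0 (s i u) (a ⋆ b ⋆ c)) (act0 (s i u) y) (act1 (o i u) (cmp (e1 ⋅ idn c) e2)).
    by apply: (hom_act HP ui.1); rewrite ?src_cmp ?tgt_cmp.
  have H2 : hom (act0 (s i u) (a ⋆ b ⋆ c)) (act0 (s i u) y) (act1 (o i u) (cmp (idn a ⋅ e3) e4)).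
    by apply: (hom_act HP ui.1); rewrite ?src_cmp ?tgt_cmp.
  apply: (cP_cancelr HP hil H1 H2).
  rewrite -!(act_unit_cmp HP ui) //.
  have G1' : hom (act0 (s i u) (a ⋆ b ⋆ c)) (act0 (act0 (s i u) d) c) (act1 (o i u) (e1 ⋅ idn c)).
    by rewrite -(act0_split HP _ _ (sS _ _ Ui)); apply: (hom_act HP ui.1); rewrite // t1 /e2 !twoE sikl !grp0E.
  have G2 := hom_cell ui sikl tikl.
  have G3 : hom (act0 (s i u) (a ⋆ b ⋆ c)) (act0 (act0 (s i u) a) f) (act1 (o i u) (idn a ⋅ e3)).
    by rewrite -(act0_split HP _ _ (sS _ _ Ui)); apply: (hom_act HP ui.1); rewrite // t2 /e4 !twoE sijl !grp0E.
  have G4 := hom_cell ui sijl tijl.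
  rewrite -(hom_cPA HP G1' G2 hil) -(coh _ _ _ _ Ui Uk Ul).
  rewrite -(hom_cPA HP G3 G4 hil) -(coh _ _ _ _ Ui Uj Ul).
  rewrite (hom_cPA HP G1' (hom_act_idn HP _ hik) hkl).
  rewrite (act1_split HP _ _ ui.1) -(act_cP_idn HP _ (hom_cell ui sijk tijk) hik) -coh //.
  rewrite (hom_cPA HP G3 (hom_act_idn HP _ hij) hjl).
  (* The cell [e3] belongs to s_j but acts on s_i x_ij. Each of the two positions, composed with a
     translate of h_ij, equals h_ij acted on by [e3], so the cell moves across the link. *)
  have hije : act1 (h i j u) e3 = cP (act1 (act1 (o i u) (idn a)) e3) (act1 (h i j u) (idn f)).
    rewrite (act_splitl HP e3 (unit_at_act HP a ui) hij); congr (cP _ (act1 _ (idn _))).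
    by rewrite /e3 !twoE tjkl.
  rewrite (act1_split HP _ _ ui.1) -hije (act_splitr HP e3 uj hij).
  have se3' : src e3 = b ⋆ c by rewrite /e3 !twoE sjkl !grp0E.
  have hije3 : hom (act0 (act0 (s i u) a) (b ⋆ c)) (act0 (s j u) (b ⋆ c)) (act1 (h i j u) (idn (src e3))).
    by rewrite se3'; exact: (hom_act_idn HP).
  have hje3 := hom_cell uj sjkl tjkl.
  rewrite -(act0_split HP _ _ (sS _ _ Uj)) in hje3.
  rewrite -(hom_cPA HP hije3 hje3 hjl) -(coh _ _ _ _ Uj Uk Ul).
  rewrite (act_cP_idn HP _ (hom_act_idn HP _ hij) hjk) se3' idn_mul (act1_split HP _ _ hij).
  have hijbc := hom_act_idn HP c (hom_act_idn HP b hij).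
  by rewrite -(hom_cPA HP hijbc (hom_act_idn HP c hjk) hkl).
(* As products, the middle identities cancel and both sides end in 1_a 1_b 1_c; what remains in
   front is the cocycle identity. *)
move: A; rewrite !cmpE /conj /e1 /e2 /e3 /e4; last 2 first.
- by rewrite /e1 /e2 /e3 /e4 !twoE -tjkl sijl !grp0E.
- by rewrite /e1 /e2 /e3 /e4 !twoE tijk sikl !grp0E.
rewrite -tijk -tjkl !twoE !grp1E => A.
by apply: (@mul1Ir _ (idn a ⋅ idn b ⋅ idn c)); rewrite !grp1E.
Qed.

End TwoSpace.
End Frames.

(** * Comparing cocycles presented by one bundle *)

Section Presents.
Variables (G : twoGroup) (X : topologicalType).

Lemma restrict_cocycle (U V : ocover X) (lam : cidx V -> cidx U) (c : cocycle G U) :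
  (forall j, cset V j `<=` cset U (lam j)) -> is_cocycle c -> is_cocycle (restrict lam c).
Proof.
move=> VU [c1 [c2 [c3 c4]]]; split=> [i j|].
  by apply: within_sub (c1 _ _) _ => u [/VU ? /VU].
split=> [i j k|].
  by apply: within_sub (c2 _ _ _) _ => u [[/VU ? /VU ?] /VU].
by split=> *; [apply: c3|apply: c4]; exact: VU.
Qed.

Lemma restrict_presents (P : space2 G X) (U V : ocover X) (lam : cidx V -> cidx U)
    (c : cocycle G U) : (forall j, cset V j `<=` cset U (lam j)) ->
  presents P c -> presents P (restrict lam c).
Proof.
move=> VU [/(restrict_cocycle VU) cc [s [o [h [F coh]]]]]; split=> //.
exists (s \o lam), (o \o lam), (fun i j => h (lam i) (lam j)); split.
  split=> [i u /VU|i u /VU|i j u /VU Ui /VU|i|i|i j|i j].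
  - exact: (frame_sec F).
  - exact: (frame_unit F).
  - exact: (frame_hom F).
  - exact: within_sub (frame_sec_cont F (lam i)) (VU i).
  - exact: within_sub (frame_unit_cont F (lam i)) (VU i).
  - by apply: within_sub (frame_cx_cont F (lam i) (lam j)) _ => u [/VU ? /VU].
  - by apply: within_sub (frame_hom_cont F (lam i) (lam j)) _ => u [/VU ? /VU].
by move=> i j k u /VU Ui /VU Uj /VU Uk; exact: coh.
Qed.

(** The sections, units and links are transported while [cx c] and [ce c] stay fixed: an equivariant
    functor preserves the coherence equation. *)
Lemma presents_morphism (P Q : space2 G X) (U : ocover X) (c : cocycle G U) :
  is_2space P -> bundle_morphism P Q -> presents P c -> presents Q c.
Proof.
move=> HP [F0 [F1 [F0_in [F1_in [F1_cP [F0_act [F1_act [F_proj [cF0 cF1]]]]]]]]].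
move=> [cc [s [o [h [F coh]]]]]; split=> //.
have F1_hom p q f : hom p q f -> hom (F0 p) (F0 q) (F1 f).
  by move=> [fS <- <-]; have [? [? ?]] := F1_in _ fS; split.
exists (fun i => F0 \o s i), (fun i => F1 \o o i), (fun i j => F1 \o h i j); split.
  split=> [i u Ui|i u Ui|i j u Ui Uj|i|i||i j] /=.
  - by have [sS sp] := frame_sec F Ui; rewrite F_proj //; split=> //; exact: F0_in.
  - have [hm mm] := frame_unit F Ui; split; first exact: F1_hom.
    by rewrite -F1_cP ?mm //; exact: (hom_composable hm hm).
  - rewrite -F0_act; last by have [] := frame_sec F Ui.
    exact/F1_hom/(frame_hom F).
  - by apply: within_comp cF0 (frame_sec_cont F i) _ => u /(frame_sec F)[].
  - by apply: within_comp cF1 (frame_unit_cont F i) _ => u /(frame_unit F)[[]].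
  - exact: (frame_cx_cont F).
  - by apply: within_comp cF1 (frame_hom_cont F i j) _ => u [Ui Uj]; case: (frame_hom F Ui Uj).
move=> i j k u Ui Uj Uk /=.
have [hij _ _] := frame_hom F Ui Uj; have [hik _ _] := frame_hom F Ui Uk.
have [[oS _ _] _] := frame_unit F Ui.
have [/(_ i j k u Ui Uj Uk)[se te] _] := cc.2.2.
rewrite -!F1_act // -!F1_cP; first by rewrite coh.
- exact: hom_composable (hom_cell HP (frame_unit F Ui) se te) (frame_hom F Ui Uk).
- exact: hom_composable (hom_act_idn HP _ (frame_hom F Ui Uj)) (frame_hom F Uj Uk).
Qed.

Lemma principal_presents (P : space2 G X) : principal P ->
  exists (U : ocover X) (c : cocycle G U), presents P c.
Proof.
move=> [HP [I [T [opT [covT chT]]]]].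
pose U := OCover opT covT.
have [s Hs] := choice (fun i => chart_section (chT i)).
have [e [ce He]] := unit_atE HP.
have Hx (p : I * I) : exists xh : (X -> G0 G) * (X -> mor P),
   let A := T p.1 `&` T p.2 in
    [/\ {within A, continuous xh.1}, {within A, continuous xh.2} &
        forall u, A u -> hom (act0 (s p.1 u) (xh.1 u)) (s p.2 u) (xh.2 u)].
  case: p => i j /=.
  have [|||||x [h Hxh]] := @chart_connect _ _ _ HP (T i) (T i `&` T j) (s i) (s j) (chT i).
  - by move=> u [].
  - by apply: within_sub (Hs i).1 _ => u [].
  - by apply: within_sub (Hs j).1 _ => u [].
  - by move=> u [Ti _]; exact: (Hs i).2.
  - by move=> u [_ Tj]; exact: (Hs j).2.
  by exists (x, h).
have [xh Hxh] := choice Hx.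
have F : frame (P := P) (U := U) (fun i j => (xh (i, j)).1) s (fun i => e \o s i)
    (fun i j => (xh (i, j)).2).
  split=> [i u|i u /(Hs i).2[sS _]|i j u Ui Uj|i|i|i j|i j] /=.
  - exact: (Hs i).2.
  - by have [] := He _ sS.
  - by have [_ _] := Hxh (i, j); apply.
  - exact: (Hs i).1.
  - by apply: within_comp ce (Hs i).1 _ => u /(Hs i).2[].
  - by have [] := Hxh (i, j).
  - by have [] := Hxh (i, j).
have [|ee [Hee coh]] := frame_cocycle HP F; first by move=> i; exists (T i).
by exists U, (@Cocycle G X U (fun i j => (xh (i, j)).1) ee); split=> //; do 3 eexists; split; first exact: F.
Qed.

(** Components of a cocycle are total functions on X, so agreement on the overlaps does not make two
    cocycles equal; the trivial coboundary absorbs the values elsewhere. *)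
Lemma eq_cohomologous (U : ocover X) (c c' : cocycle G U) :
  (forall i j v, cset U i v -> cset U j v -> cx c i j v = cx c' i j v) ->
  (forall i j k v, cset U i v -> cset U j v -> cset U k v -> ce c i j k v = ce c' i j k v) ->
  cohomologous c c'.
Proof.
move=> ex ee; exists (fun _ _ => one0), (fun _ _ _ => one1); split; first by move=> i; exact: within_cst.
split; first by move=> i j; exact: within_cst.
split=> [i j v Ui Uj|i j k v Ui Uj Uk].
  by rewrite src1 tgt1 -ex // !grp0E.
by rewrite -ee // /Defs.conj !twoE !grp1E.
Qed.

(* The two families of sections, put side by side, form one frame over the cover
   in which every member of [W] is listed twice; its cocycle restricts to [c] along
   one inclusion of indices and to [c'] along the other. *)
Lemma presents_cech_eq_on (P : space2 G X) (W : ocover X) (c c' : cocycle G W) :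
  is_2space P -> (forall i, exists2 T, chart P T & cset W i `<=` T) ->
  presents P c -> presents P c' -> cech_eq (existT _ W c) (existT _ W c').
Proof.
move=> HP WT [cc [s [o [h [F coh]]]]] [cc' [s' [o' [h' [F' coh']]]]].
have Hx (s1 s2 : cidx W -> X -> ob P) :
    (forall i, {within cset W i, continuous (s1 i)}) ->
    (forall i, {within cset W i, continuous (s2 i)}) ->
    (forall i u, cset W i u -> obS (s1 i u) /\ proj (s1 i u) = u) ->
    (forall i u, cset W i u -> obS (s2 i u) /\ proj (s2 i u) = u) ->
    exists xh : cidx W * cidx W -> (X -> G0 G) * (X -> mor P), forall p,
     let A := cset W p.1 `&` cset W p.2 in
      [/\ {within A, continuous (xh p).1}, {within A, continuous (xh p).2} &
        forall u, A u -> hom (act0 (s1 p.1 u) ((xh p).1 u)) (s2 p.2 u) ((xh p).2 u)].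
  move=> cs1 cs2 Hs1 Hs2.
  suff /choice[xh Hxh] : forall p : cidx W * cidx W, exists xh : (X -> G0 G) * (X -> mor P),
     let A := cset W p.1 `&` cset W p.2 in
      [/\ {within A, continuous xh.1}, {within A, continuous xh.2} &
        forall u, A u -> hom (act0 (s1 p.1 u) (xh.1 u)) (s2 p.2 u) (xh.2 u)].
    by exists xh.
  case=> i j /=; have [T chT WiT] := WT i.
  have [|||||x [g Hg]] := @chart_connect _ _ _ HP T (cset W i `&` cset W j) (s1 i) (s2 j) chT.
  - by move=> u [/WiT].
  - by apply: within_sub (cs1 i) _ => u [].
  - by apply: within_sub (cs2 j) _ => u [].
  - by move=> u [? _]; exact: Hs1.
  - by move=> u [_ ?]; exact: Hs2.
  by exists (x, g).
(* Links from the first family to the second and back are chosen independently; they need not be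
   mutually inverse, since the cells of the doubled frame account for any discrepancy. *)
have [m Hm] := Hx _ _ (frame_sec_cont F) (frame_sec_cont F') (frame_sec F) (frame_sec F').
have [m' Hm'] := Hx _ _ (frame_sec_cont F') (frame_sec_cont F) (frame_sec F') (frame_sec F).
pose J := (cidx W + cidx W)%type.
pose R (a : J) := match a with inl i | inr i => cset W i end.
have opR a : open (R a) by case: a => i; exact: cset_open.
have covR x : exists a, R a x by have [i Wi] := cset_cover W x; exists (inl i).
pose V := OCover opR covR.
pose sV (a : J) := match a with inl i => s i | inr i => s' i end.
pose oV (a : J) := match a with inl i => o i | inr i => o' i end.
(* Within each family the given transition functions and links are kept, so that restriction returns
   [cx c] and [cx c'] on the nose and only the cells have to be compared. *)
pose xV (a b : J) := match a, b with
  | inl i, inl j => cx c i j | inl i, inr j => (m (i, j)).1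
  | inr i, inl j => (m' (i, j)).1 | inr i, inr j => cx c' i j end.
pose hV (a b : J) := match a, b with
  | inl i, inl j => h i j | inl i, inr j => (m (i, j)).2
  | inr i, inl j => (m' (i, j)).2 | inr i, inr j => h' i j end.
have FV : frame (P := P) (U := V) xV sV oV hV.
  split=> [[]i|[]i|[]i []j u Ri Rj|[]i|[]i|[]i []j|[]i []j] /=.
  - exact: (frame_sec F).
  - exact: (frame_sec F').
  - exact: (frame_unit F).
  - exact: (frame_unit F').
  - exact: (frame_hom F).
  - by have [_ _] := Hm (i, j); apply.
  - by have [_ _] := Hm' (i, j); apply.
  - exact: (frame_hom F').
  - exact: (frame_sec_cont F i).
  - exact: (frame_sec_cont F' i).
  - exact: (frame_unit_cont F i).
  - exact: (frame_unit_cont F' i).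
  - exact: (frame_cx_cont F i j).
  - by have [] := Hm (i, j).
  - by have [] := Hm' (i, j).
  - exact: (frame_cx_cont F' i j).
  - exact: (frame_hom_cont F i j).
  - by have [] := Hm (i, j).
  - by have [] := Hm' (i, j).
  - exact: (frame_hom_cont F' i j).
have [|e [He cohV]] := frame_cocycle HP FV.
  by case=> i; exact: WT.
set C : cocycle G V := @Cocycle G X V xV e in He.
pose L (i : cidx W) : cidx V := inl i.
pose L' (i : cidx W) : cidx V := inr i.
have HL : is_cocycle (restrict (V := W) L C) by apply: restrict_cocycle => // j u.
have HL' : is_cocycle (restrict (V := W) L' C) by apply: restrict_cocycle => // j u.
have stepL : cech_eq (existT _ V C) (existT _ W (restrict (V := W) L C)).
  by apply: rst_step; right; exists V, W, L, C; split; [|split=> [j|]].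
have stepL' : cech_eq (existT _ V C) (existT _ W (restrict (V := W) L' C)).
  by apply: rst_step; right; exists V, W, L', C; split; [|split=> [j|]].
(* The restricted cells and [ce c] are coherent for the same frame, so uniqueness makes them agree
   on the overlaps. *)
have eqL : cech_eq (existT _ W c) (existT _ W (restrict (V := W) L C)).
  apply: rst_step; left; exists W, c, (restrict (V := W) L C); do 2 (split=> //).
  split=> //; apply: eq_cohomologous => // i j k u.
  have H : is_cocycle (Cocycle (cx c) (ce c)) by case: (c) cc.
  apply: (coherent_uniq HP F WT H HL coh) => {}i {}j {}k {}u Wi Wj Wk.
  exact: (cohV (inl i) (inl j) (inl k)).
have eqL' : cech_eq (existT _ W c') (existT _ W (restrict (V := W) L' C)).
  apply: rst_step; left; exists W, c', (restrict (V := W) L' C); do 2 (split=> //).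
  split=> //; apply: eq_cohomologous => // i j k u.
  have H : is_cocycle (Cocycle (cx c') (ce c')) by case: (c') cc'.
  apply: (coherent_uniq HP F' WT H HL' coh') => {}i {}j {}k {}u Wi Wj Wk.
  exact: (cohV (inr i) (inr j) (inr k)).
apply: rst_trans eqL _; apply: rst_trans (rst_sym _ _ _ _ stepL) _.
exact: rst_trans stepL' (rst_sym _ _ _ _ eqL').
Qed.

Lemma presents_cech_eq (P : space2 G X) (U V : ocover X) (c : cocycle G U)
    (c' : cocycle G V) :
  principal P -> presents P c -> presents P c' ->
  cech_eq (existT _ U c) (existT _ V c').
Proof.
move=> [HP [I [T [opT [covT chT]]]]] pc pc'.
(* Intersecting also with [T] puts every member of the common refinement inside a trivializing
   chart. *)
pose R (a : cidx U * cidx V * I) := cset U a.1.1 `&` cset V a.1.2 `&` T a.2.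
have opR a : open (R a) by apply: openI => //; apply: openI; exact: cset_open.
have covR x : exists a, R a x.
  have [i Ui] := cset_cover U x; have [j Vj] := cset_cover V x.
  by have [k Tk] := covT x; exists (i, j, k).
pose W := OCover opR covR.
pose l (a : cidx W) := a.1.1; pose l' (a : cidx W) := a.1.2.
have lE a : cset W a `<=` cset U (l a) by move=> u [[]].
have l'E a : cset W a `<=` cset V (l' a) by move=> u [[]].
apply: (rst_trans _ _ _ (existT _ W (restrict l c))).
  by apply: rst_step; right; exists U, W, l, c; split=> //; case: pc.
apply: (rst_trans _ _ _ (existT _ W (restrict l' c'))); last first.
  by apply/rst_sym/rst_step; right; exists V, W, l', c'; split=> //; case: pc'.
apply: (presents_cech_eq_on HP); [|exact: restrict_presents|exact: restrict_presents].
by move=> a; exists (T a.2) => // u [].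
Qed.

End Presents.

(** * The bundle of a cocycle *)

Section Whisker.
Variable G : twoGroup.
Implicit Types (x y : G0 G) (g h e : G1 G).

(** Interchange with e = 1 * e, where 1 is the identity at the source of e. *)
Lemma cmp_mulr e g h : src e = one0 -> tgt g = src h -> cmp g (e ⋅ h) = e ⋅ cmp g h.
Proof.
move=> se gh; have eE : cmp one1 e = e by rewrite one1E -se cmp_idl.
by rewrite -{2}eE interchange ?mul11x // tgt1 se.
Qed.

Lemma cmp_mull e g h : tgt g = src h -> cmp (e ⋅ g) (idn (tgt e) ⋅ h) = e ⋅ cmp g h.
Proof. by move=> gh; rewrite -interchange ?src_idn // cmp_idr. Qed.

Lemma idn_cmp x g h : tgt g = src h ->
  idn x ⋅ cmp g h = cmp (idn x ⋅ g) (idn x ⋅ h).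
Proof.
move=> gh; rewrite -interchange ?src_idn ?tgt_idn //.
by have := cmp_idr (idn x); rewrite tgt_idn => ->.
Qed.

Lemma within_cmp (T : topologicalType) (A : set T) (f h : T -> G1 G) :
  {within A, continuous f} -> {within A, continuous h} ->
  (forall t, A t -> tgt (f t) = src (h t)) ->
  {within A, continuous (fun t => cmp (f t) (h t))}.
Proof. by move=> cf ch fh; exact: (within_comp2 (@cmp_cont G)). Qed.

Lemma within_cinv (T : topologicalType) (A : set T) (f : T -> G1 G) :
  {within A, continuous f} -> {within A, continuous (fun t => cinv (f t))}.
Proof. by apply: within_cont_comp; exact: cinv_cont. Qed.

End Whisker.

Section Bundle.
Variables (G : twoGroup) (X : topologicalType) (U : ocover X) (c : cocycle G U).
Hypothesis Hc : is_cocycle c.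

Lemma within_idx1 (S T : topologicalType) (f : cidx U -> X -> S) (A : set T)
    (i : T -> Idx U) (v : T -> X) :
  (forall a, {within cset U a, continuous (f a)}) ->
  {within A, continuous i} -> {within A, continuous v} ->
  (forall t, A t -> cset U (i t) (v t)) ->
  {within A, continuous (fun t => f (i t) (v t))}.
Proof.
move=> cf ci cv Hv.
apply: (within_discrete (D := discrete_topology {classic (cidx U)})
  (f := fun a t => f a (v t)) ci) => a.
apply: within_comp (cf a) _ _; first by apply: within_sub cv _ => t [].
by move=> t [/Hv Hi <-].
Qed.

Lemma within_idx2 (S T : topologicalType) (f : cidx U -> cidx U -> X -> S) (A : set T)
    (i j : T -> Idx U) (v : T -> X) :
  (forall a b, {within cset U a `&` cset U b, continuous (f a b)}) ->
  {within A, continuous i} -> {within A, continuous j} -> {within A, continuous v} ->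
  (forall t, A t -> cset U (i t) (v t) /\ cset U (j t) (v t)) ->
  {within A, continuous (fun t => f (i t) (j t) (v t))}.
Proof.
move=> cf ci cj cv Hv.
apply: (within_discrete (D := discrete_topology {classic (cidx U)})
  (f := fun a t => f a (j t) (v t)) ci) => a.
apply: (within_discrete (D := discrete_topology {classic (cidx U)})
  (f := fun b t => f a b (v t))).
  by apply: within_sub cj _ => t [].
move=> b; apply: within_comp (cf a b) _ _; first by apply: within_sub cv _ => t [[]].
by move=> t [[/Hv[Hi Hj] <-] <-].
Qed.

Lemma within_cx (T : topologicalType) (A : set T) (i j : T -> Idx U) (v : T -> X) :
  {within A, continuous i} -> {within A, continuous j} -> {within A, continuous v} ->
  (forall t, A t -> cset U (i t) (v t) /\ cset U (j t) (v t)) ->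
  {within A, continuous (fun t => cx c (i t) (j t) (v t))}.
Proof. exact: within_idx2 Hc.1. Qed.

Lemma within_ce (T : topologicalType) (A : set T) (i j k : T -> Idx U) (v : T -> X) :
  {within A, continuous i} -> {within A, continuous j} -> {within A, continuous k} ->
  {within A, continuous v} ->
  (forall t, A t -> [/\ cset U (i t) (v t), cset U (j t) (v t) & cset U (k t) (v t)]) ->
  {within A, continuous (fun t => ce c (i t) (j t) (k t) (v t))}.
Proof.
move=> ci cj ck cv Hv.
apply: (within_discrete (D := discrete_topology {classic (cidx U)})
  (f := fun a t => ce c a (j t) (k t) (v t)) ci) => a.
apply: (within_discrete (D := discrete_topology {classic (cidx U)})
  (f := fun b t => ce c a b (k t) (v t))).
  by apply: within_sub cj _ => t [].
move=> b; apply: (within_discrete (D := discrete_topology {classic (cidx U)})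
  (f := fun d t => ce c a b d (v t))).
  by apply: within_sub ck _ => t [[]].
move=> d; apply: within_comp (Hc.2.1 a b d) _ _; first by apply: within_sub cv _ => t [[[]]].
by move=> t [[[/Hv[Hi Hj Hk] <-] <-] <-].
Qed.

Lemma ce_src i j k v : cset U i v -> cset U j v -> cset U k v -> src (ce c i j k v) = one0.
Proof. by move=> Ui Uj Uk; case: (Hc.2.2.1 _ _ _ _ Ui Uj Uk). Qed.

Lemma ce_tgt i j k v : cset U i v -> cset U j v -> cset U k v ->
  tgt (ce c i j k v) = cx c i k v ⋆ inv0 (cx c j k v) ⋆ inv0 (cx c i j v).
Proof. by move=> Ui Uj Uk; case: (Hc.2.2.1 _ _ _ _ Ui Uj Uk) => _ <-; rewrite !grp0E. Qed.

Lemma cx_diag i v : cset U i v -> cx c i i v = tgt (inv1 (ce c i i i v)).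
Proof. by move=> Ui; rewrite !twoE ce_tgt // !grp0E. Qed.

Lemma ce_cocycle i j k l v : cset U i v -> cset U j v -> cset U k v -> cset U l v ->
  ce c i k l v ⋅ ce c i j k v
  = ce c i j l v ⋅ idn (cx c i j v) ⋅ ce c j k l v ⋅ inv1 (idn (cx c i j v)).
Proof.
by move=> Ui Uj Uk Ul; rewrite (Hc.2.2.2 _ _ _ _ _ Ui Uj Uk Ul) /Defs.conj idn_inv !grp1E.
Qed.

(** Cocycles are not normalized. The identity at (i,i,i,l) says that e_iii is e_iil conjugated by
    x_ii = t(e_iii)^{-1}, and Peiffer turns this into conjugation by e_iii^{-1}. *)
Lemma ce_diagl i l v : cset U i v -> cset U l v -> ce c i i l v = ce c i i i v.
Proof.
move=> Ui Ul; have := ce_cocycle Ui Ui Ui Ul.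
rewrite -!mul1A => /mul1I; rewrite mul1A cx_diag // peiffer ?twoE ?ce_src ?inv01 //.
rewrite inv1K => /(congr1 (mul1 (ce c i i i v))); rewrite !grp1E.
by move/mul1Ir.
Qed.

Lemma ce_diagr i j v : cset U i v -> cset U j v ->
  ce c i j j v ⋅ idn (cx c i j v) = idn (cx c i j v) ⋅ ce c j j j v.
Proof.
move=> Ui Uj; have := ce_cocycle Ui Uj Uj Uj.
by rewrite -!mul1A => /mul1I ->; rewrite !grp1E.
Qed.

Lemma cmp_ce i j k v g h : cset U i v -> cset U j v -> cset U k v ->
  tgt g = cx c i j v ⋆ cx c j k v ⋆ src h ->
  cmp (ce c i j k v ⋅ g) (idn (cx c i k v) ⋅ h)
  = ce c i j k v ⋅ cmp g (idn (cx c i j v) ⋅ idn (cx c j k v) ⋅ h).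
Proof.
move=> Ui Uj Uk gh; rewrite -cmp_mull ?twoE //; congr cmp.
by rewrite ce_tgt // !twoE !grp1E.
Qed.

(** The product in [Pc] multiplies by e_iii on the left, which the factor e_iii^{-1} compensates. *)
Definition pc_unit (p : ob (Pc c)) : mor (Pc c) :=
  (((p.1.1, p.1.1), p.1.2), inv1 (ce c p.1.1 p.1.1 p.1.1 p.1.2) ⋅ idn p.2).

(** The solution of f * f' = unit: the first two factors undo the 1_{x_ij} and e_iji introduced by
    the product, the third is the one in [pc_unit]. *)
Definition pc_inv (m : mor (Pc c)) : mor (Pc c) :=
  let: (i, j, v) := (m.1.1.1, m.1.1.2, m.1.2) in
  (((j, i), v), inv1 (idn (cx c i j v)) ⋅ inv1 (ce c i j i v) ⋅ inv1 (ce c i i i v)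
                ⋅ cinv m.2).

Lemma pc_composableP (f g : mor (Pc c)) : composable f g ->
  exists i j k v g1 g2, [/\ f = (((i, j), v), g1), g = (((j, k), v), g2),
    tgt g1 = cx c i j v ⋆ src g2 & [/\ cset U i v, cset U j v & cset U k v]].
Proof.
case: f => [[[i j] v] g1]; case: g => [[[j' k] v'] g2].
case=> [[/= Ui Uj] [[/= Uj' Uk] E]]; case: E => jj vv E; subst j' v'.
by exists i, j, k, v, g1, g2; split=> //; rewrite -E !grp0E.
Qed.

(** Once the cells are pulled out of the compositions, the two bracketings differ by e_ikl e_ijk
    against e_ijl conjugated with e_jkl, which is the cocycle identity. *)
Lemma pc_cPA (f g h : mor (Pc c)) : composable f g -> composable g h ->
  cP f (cP g h) = cP (cP f g) h.
Proof.
move=> /pc_composableP[i [j [k [v [g1 [g2 [-> -> E1 [Ui Uj Uk]]]]]]]].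
move=> /pc_composableP[j' [k' [l [v' [g2' [g3 [[<- <- <- <-] -> E2 [_ _ Ul]]]]]]]] /=.
congr pair; set a := cx c i j v in E1 *; set b := cx c j k v in E2 *.
have T1 : tgt g1 = src (idn a ⋅ g2) by rewrite !twoE.
have T2 : tgt g2 = src (idn b ⋅ g3) by rewrite !twoE.
rewrite cmp_ce //; last by rewrite tgt_cmp // !twoE E2 !grp0E.
have -> : idn a ⋅ (ce c j k l v ⋅ cmp g2 (idn b ⋅ g3))
  = (idn a ⋅ ce c j k l v ⋅ inv1 (idn a)) ⋅ (idn a ⋅ cmp g2 (idn b ⋅ g3)) by rewrite !grp1E.
rewrite cmp_mulr; first last.
- by rewrite src_mul src_cmp // T1 !twoE.
- by rewrite !twoE ce_src // !grp0E.
rewrite idn_cmp // cmpA //; last by rewrite !twoE E2 !grp0E.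
rewrite !mul1A -ce_cocycle // -!mul1A; congr (_ ⋅ (_ ⋅ cmp _ _)).
Qed.

Lemma pc_idl (f : mor (Pc c)) : morS f -> cP (pc_unit (sP f)) f = f.
Proof.
case: f => [[[i j] v] g] [/= Ui Uj] /=; congr pair.
have -> : idn (cx c i i v) = idn (tgt (inv1 (ce c i i i v))) by rewrite cx_diag.
by rewrite cmp_mull ?tgt_idn // ce_diagl // cmp_idl !grp1E.
Qed.

Lemma pc_idr (f : mor (Pc c)) : morS f -> cP f (pc_unit (tP f)) = f.
Proof.
case: f => [[[i j] v] g] [/= Ui Uj]; rewrite /pc_unit /=; congr pair.
set a := cx c i j v.
have -> : idn a ⋅ (inv1 (ce c j j j v) ⋅ idn (inv0 a ⋆ tgt g))
  = (idn a ⋅ inv1 (ce c j j j v) ⋅ inv1 (idn a)) ⋅ idn (tgt g) by rewrite !twoE !grp1E.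
rewrite cmp_mulr ?src_idn //; last by rewrite !twoE ce_src // !grp0E.
by rewrite cmp_idr !mul1A ce_diagr // !grp1E.
Qed.

Lemma pc_unit_hom (p : ob (Pc c)) : obS p -> hom p p (pc_unit p).
Proof.
case: p => [[i v] x] /= Ui; split=> //=; congr pair.
  by rewrite !twoE ce_src // !grp0E.
by rewrite tgt_mul -cx_diag // !twoE !grp0E.
Qed.

Lemma pc_inv_hom (f : mor (Pc c)) : morS f -> hom (tP f) (sP f) (pc_inv f).
Proof.
case: f => [[[i j] v] g] [/= Ui Uj]; split=> //=; congr pair.
  by rewrite !twoE !ce_src // src_cinv !grp0E.
by rewrite !twoE !ce_tgt // tgt_cinv !grp0E.
Qed.

Lemma pc_invr (f : mor (Pc c)) : morS f -> cP f (pc_inv f) = pc_unit (sP f).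
Proof.
case: f => [[[i j] v] g] [/= Ui Uj]; rewrite /pc_inv /pc_unit /=; congr pair.
rewrite !mul1A mul1xV mul11x cmp_mulr ?src_cinv //; last by rewrite !twoE !ce_src // !grp0E.
by rewrite cmp_cinv !grp1E.
Qed.

(** Right inverses suffice: [pc_inv f] has the right inverse [pc_inv (pc_inv f)], which must then be
    f. *)
Lemma pc_invl (f : mor (Pc c)) : morS f -> cP (pc_inv f) f = pc_unit (tP f).
Proof.
move=> fS; have [iS si ti] := pc_inv_hom fS; have [iiS sii tii] := pc_inv_hom iS.
have fi : composable f (pc_inv f) by split=> //; split=> //; rewrite si.
have fii : composable (pc_inv f) (pc_inv (pc_inv f)) by split=> //; split=> //; rewrite sii.
have : f = pc_inv (pc_inv f).
  rewrite -[LHS]pc_idr // -si -(pc_invr iS) pc_cPA // pc_invr // -ti -sii.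
  exact: pc_idl.
by move=> {2}->; rewrite pc_invr // si.
Qed.

Ltac within_auto := repeat first
  [ apply: within_id | apply: within_cst | apply: within_pair
  | apply: within_mul0 | apply: within_mul1 | apply: within_inv0 | apply: within_inv1
  | apply: within_idn | apply: within_src | apply: within_tgt | apply: within_cinv
  | apply: within_cx | apply: within_ce | apply: within_cmp
  | apply: within_fst | apply: within_snd ].

Lemma pc_is_2space : is_2space (Pc c).
Proof.
split.
- by case=> [[[i j] v] g] [].
- by case=> [[[i j] v] g] [].
- by move=> f g /pc_composableP[i [j [k [v [g1 [g2 [-> -> _ []]]]]]]].
- move=> f g /pc_composableP[i [j [k [v [g1 [g2 [-> -> E [Ui Uj Uk]]]]]]]] /=; congr pair.
  by rewrite src_mul src_cmp ?ce_src ?grp0E // !twoE.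
- move=> f g /pc_composableP[i [j [k [v [g1 [g2 [-> -> E [Ui Uj Uk]]]]]]]] /=; congr pair.
  by rewrite tgt_mul tgt_cmp ?twoE // ce_tgt // !grp0E.
- exact: pc_cPA.
- exists pc_unit, pc_inv; split; first by move=> p /pc_unit_hom[].
  split; first by move=> f fS; rewrite pc_idl // pc_idr.
  split.
    move=> f fS; have [iS si ti] := pc_inv_hom fS.
    by rewrite pc_invr // pc_invl.
  split; rewrite /pc_unit /pc_inv /=; within_auto.
  + by move=> [[i v] x].
  + by move=> [[[i j] v] g].
  + by move=> [[[i j] v] g] [].
  + by move=> [[[i j] v] g] [].
- within_auto.
- by within_auto.
- rewrite /=; within_auto.
  + by move=> [f g] /pc_composableP[i [j [k [v [g1 [g2 [/= fE gE E []]]]]]]]; subst f g.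
  + by move=> [f g] /pc_composableP[i [j [k [v [g1 [g2 [/= fE gE E []]]]]]]]; subst f g.
  + by move=> [f g] /pc_composableP[i [j [k [v [g1 [g2 [/= fE gE E []]]]]]]]; subst f g; rewrite /= !twoE.
- by [].
- by [].
- by move=> [[[i j] v] g] h [/= Ui Uj]; rewrite src_mul.
- by move=> [[[i j] v] g] h [/= Ui Uj]; rewrite tgt_mul mul0A.
- move=> f f' g g' /pc_composableP[i [j [k [v [g1 [g2 [-> -> E [Ui Uj Uk]]]]]]]] gg /=.
  by congr pair; rewrite -mul1A interchange ?mul1A // !twoE.
- by move=> [p x] _ /=; rewrite mul0x1.
- by move=> [p x] y z _ /=; rewrite mul0A.
- by move=> [p g] _ /=; rewrite mul1x1.
- by move=> [p g] y z _ /=; rewrite mul1A.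
- by within_auto.
- by within_auto.
- by [].
- by within_auto.
Qed.

(** The morphism (v, 1_{x_ij x})_ij from (v, x_ij x)_i to (v, x)_j serves as [eta], so [phi0] is its
    source, and [phi1] is the group component of [eta] composed with a morphism. The functor back
    includes the summand with index i. *)
Lemma pc_chart i : chart (Pc c) (cset U i).
Proof.
exists (fun p : ob (Pc c) => cx c i p.1.1 p.1.2 ⋆ p.2).
exists (fun m : mor (Pc c) => ce c i m.1.1.1 m.1.1.2 m.1.2
                              ⋅ idn (cx c i m.1.1.1 m.1.2) ⋅ m.2).
exists (fun u x => ((i, u), x)).
exists (fun u g => (((i, i), u), inv1 (ce c i i i u) ⋅ g)).
exists (fun p : ob (Pc c) => (((i, p.1.1), p.1.2), idn (cx c i p.1.1 p.1.2 ⋆ p.2))).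
(* As x_ii need not be 1, the composite on the model moves x to x_ii x; e_iii leads back because
   t(e_iii) x_ii = 1. *)
exists (fun u x => ce c i i i u ⋅ idn (cx c i i u ⋆ x)).
split.
  move=> [[[j k] v] g] [/= [Uj Uk] Ui].
  by rewrite !twoE ce_src // ce_tgt // !grp0E.
split.
  move=> f g /pc_composableP[j [k [l [v [g1 [g2 [-> -> E [Uj Uk Ul]]]]]]]] /= Ui.
  have T1 : tgt g1 = src (idn (cx c j k v) ⋅ g2) by rewrite !twoE.
  have T2 : tgt (idn (cx c i j v) ⋅ g1) = cx c i j v ⋆ cx c j k v ⋆ src g2.
    by rewrite !twoE E !grp0E.
  have eqR : cmp (ce c i j k v ⋅ idn (cx c i j v) ⋅ g1) (ce c i k l v ⋅ idn (cx c i k v) ⋅ g2)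
      = ce c i k l v ⋅ ce c i j k v ⋅ (idn (cx c i j v) ⋅ cmp g1 (idn (cx c j k v) ⋅ g2)).
    rewrite -!mul1A cmp_mulr ?ce_src //; last by rewrite !twoE ce_tgt // E !grp0E.
    by rewrite cmp_ce // idn_cmp // !mul1A.
  by rewrite eqR (ce_cocycle Ui Uj Uk Ul) !grp1E.
split; first by move=> [[j v] x] y _ /=; rewrite mul0A.
split; first by move=> [[[j k] v] g] h _ /=; rewrite mul1A.
split; first by rewrite /=; within_auto => -[[j v] x] [].
split.
  rewrite /=; within_auto.
  - by move=> [[[j k] v] g] [[]].
  - by move=> [[[j k] v] g] [[]].
split=> //; split.
  move=> u g Ui /=; split=> //; split; congr pair.
    by rewrite !twoE ce_src // !grp0E.
  by rewrite tgt_mul -cx_diag // !grp0E.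
split.
  move=> u g h Ui gh /=; congr pair.
  rewrite cx_diag // cmp_mull; last by rewrite !twoE ce_src // !grp0E.
  by rewrite cmp_mulr // ?twoE ?ce_src ?inv01 // !grp1E.
split=> //; split; first by move=> u g h _ /=; rewrite mul1A.
split; first by within_auto.
split; first by within_auto.
split; first by move=> [[j v] x] [/= Uj Ui]; rewrite src_idn tgt_idn !grp0E.
split.
  move=> [[[j k] v] g] [/= [Uj Uk] Ui]; congr pair.
  have -> : idn (cx c i j v ⋆ src g) = idn (src (idn (cx c i j v) ⋅ g)) by rewrite src_mul src_idn.
  rewrite cmp_idl (cx_diag Ui) cmp_mull; last first.
    by rewrite src_idn !twoE ce_tgt // !grp0E.
  have -> : idn (cx c i k v ⋆ (inv0 (cx c j k v) ⋆ tgt g))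
      = idn (tgt (ce c i j k v ⋅ idn (cx c i j v) ⋅ g)).
    by rewrite !tgt_mul tgt_idn ce_tgt // !grp0E.
  by rewrite cmp_idr ce_diagl // !grp1E.
split; first by move=> [[j v] x] y _ /=; rewrite mul0A [in LHS]idn_mul.
split; first by rewrite /=; within_auto => -[[j v] x] [].
split; first by move=> u x Ui; rewrite !twoE ce_src // ce_tgt // !grp0E.
split.
  move=> u g Ui /=; set x := cx c i i u.
  have xE : idn x = inv1 (idn (tgt (ce c i i i u))) by rewrite /x cx_diag // !twoE.
  have -> : cmp (ce c i i i u ⋅ idn (x ⋆ src g)) g = ce c i i i u ⋅ (idn x ⋅ g).
    have {2}-> : g = idn (tgt (ce c i i i u)) ⋅ (idn x ⋅ g) by rewrite xE !grp1E.
    rewrite cmp_mull ?tgt_idn ?src_mul ?src_idn //.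
    by have := cmp_idl (idn x ⋅ g); rewrite src_mul src_idn => ->.
  have -> : ce c i i i u ⋅ idn x ⋅ (inv1 (ce c i i i u) ⋅ g) = idn x ⋅ g.
    by rewrite /x ce_diagr // !grp1E.
  rewrite cmp_mulr ?ce_src // ?tgt_mul ?tgt_idn ?src_idn //.
  by have := cmp_idr (idn x ⋅ g); rewrite tgt_mul tgt_idn => ->.
split; first by move=> u x y _; rewrite mul0A [in LHS]idn_mul mul1A.
by within_auto.
Qed.

Lemma pc_principal : principal (Pc c).
Proof.
split; first exact: pc_is_2space.
exists (cidx U), (@cset _ U); split; first exact: cset_open.
by split; [exact: cset_cover|exact: pc_chart].
Qed.

Lemma pc_presents : presents (Pc c) c.
Proof.
split=> //.
pose s i u : ob (Pc c) := ((i, u), one0).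
exists s, (fun i u => pc_unit (s i u)), (fun i j u => (((i, j), u), idn (cx c i j u))).
split.
  split=> [i u Ui|i u Ui|i j u Ui Uj|i|i|i j|i j] //.
  - have [mS ms mt] := pc_unit_hom (p := s i u) Ui.
    by split=> //; have := pc_idl mS; rewrite ms.
  - split=> //=; congr pair; first by rewrite src_idn mul01x.
    by rewrite tgt_idn !grp0E.
  - by rewrite /s; within_auto.
  - by rewrite /pc_unit /s /=; within_auto.
  - exact: Hc.1.
  - by rewrite /=; within_auto => t [].
move=> i j k u Ui Uj Uk; rewrite /pc_unit /=; congr pair.
have -> : idn (cx c i k u)
    = idn (tgt (ce c i j k u ⋅ idn (cx c i j u) ⋅ idn (cx c j k u))).
  by congr idn; rewrite !twoE ce_tgt // !grp0E.
rewrite idn1 mul1x1 cx_diag // cmp_mull ?src_idn // cmp_idr ce_diagl //.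
rewrite -idn_mul; have := cmp_idr (idn (cx c i j u ⋆ cx c j k u)).
by rewrite tgt_idn => ->; rewrite idn_mul !grp1E.
Qed.

(** In [Pc] the morphism (v, g)_ij is g acting on the unit at (v, 1)_i followed by a translate of
    the link over ij, so its image is forced to be [F1]. Functoriality is coherence. *)
Lemma presents_bundle_morphism (P : space2 G X) : is_2space P ->
  (forall (p : ob P) x, obS p -> proj (act0 p x) = proj p) ->
  presents P c -> bundle_morphism (Pc c) P.
Proof.
move=> HP projA [_ [s [o [h [F coh]]]]].
have sS i u : cset U i u -> obS (s i u) by move=> /(frame_sec F)[].
pose y i j v (g : G1 G) := inv0 (cx c i j v) ⋆ tgt g.
pose F1 i j v (g : G1 G) := cP (act1 (o i v) g) (act1 (h i j v) (idn (y i j v g))).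
have H1 i v g : cset U i v ->
    hom (act0 (s i v) (src g)) (act0 (s i v) (tgt g)) (act1 (o i v) g).
  by move=> Ui; apply: (hom_act HP (frame_unit F Ui).1).
have H2 i j v x : cset U i v -> cset U j v ->
    hom (act0 (s i v) x) (act0 (s j v) (inv0 (cx c i j v) ⋆ x))
        (act1 (h i j v) (idn (inv0 (cx c i j v) ⋆ x))).
  move=> Ui Uj; have := hom_act_idn HP (inv0 (cx c i j v) ⋆ x) (frame_hom F Ui Uj).
  by rewrite -(act0_split HP _ _ (sS _ _ Ui)) !grp0E.
exists (fun p : ob (Pc c) => act0 (s p.1.1 p.1.2) p.2).
exists (fun m : mor (Pc c) => F1 m.1.1.1 m.1.1.2 m.1.2 m.2).
split; first by move=> [[i v] x] /= Ui; apply: (act0_in HP); exact: sS.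
split.
  move=> [[[i j] v] g] [/= Ui Uj].
  by have [? ? ?] := hom_cP HP (H1 _ _ g Ui) (H2 _ _ _ _ Ui Uj).
split.
  move=> f f' /pc_composableP[i [j [k [v [g [g' [-> -> E [Ui Uj Uk]]]]]]]] /=.
  rewrite /F1; set x := cx c i j v in E *; set e := ce c i j k v.
  set K := cmp g (idn x ⋅ g').
  have T1 : tgt g = src (idn x ⋅ g') by rewrite !twoE.
  have tK : tgt K = x ⋆ tgt g' by rewrite /K tgt_cmp // !twoE.
  have se : src e = one0 by exact: ce_src.
  have te : tgt e ⋆ x ⋆ cx c j k v = cx c i k v by rewrite /e ce_tgt // !grp0E.
  have yE : y i k v (e ⋅ K) = y j k v g' by rewrite /y tgt_mul tK -te !grp0E.
  have y0E : y i j v g = src g' by rewrite /y E !grp0E.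
  rewrite yE y0E; set z := y j k v g'.
  pose E1 := e ⋅ idn x ⋅ idn (cx c j k v).
  have tz : tgt g' = cx c j k v ⋆ z by rewrite /z /y !grp0E.
  (* The factor e of the product becomes a separate cell composed after [K], in the shape to which
     coherence applies. *)
  have KE : e ⋅ K = cmp K (E1 ⋅ idn z).
    rewrite -!mul1A -!idn_mul -tz -tK cmp_mulr ?cmp_idr // ?src_idn //.
  have ui := frame_unit F Ui; have uj := frame_unit F Uj.
  have hij := frame_hom F Ui Uj; have hjk := frame_hom F Uj Uk.
  have hik := frame_hom F Ui Uk.
  have sE1 : src (E1 ⋅ idn z) = tgt K by rewrite !twoE se tK tz !grp0E.
  rewrite KE -(act_unit_cmp HP ui (esym sE1)).
  have hE1 := hom_cell HP ui se te.
  have step1 : cP (act1 (o i v) (E1 ⋅ idn z)) (act1 (h i k v) (idn z))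
      = cP (act1 (h i j v) (idn (tgt g'))) (act1 (h j k v) (idn z)).
    rewrite (act1_split HP _ _ ui.1) -(act_cP_idn HP _ hE1 hik) -coh //.
    rewrite (act_cP_idn HP _ (hom_act_idn HP _ hij) hjk).
    by rewrite -(act1_split HP _ _ hij) -idn_mul -tz.
  have hK := H1 i v K Ui.
  have hW : hom (act0 (s i v) (tgt K)) (act0 (s i v) (cx c i k v ⋆ z)) (act1 (o i v) (E1 ⋅ idn z)).
    by apply: (hom_act HP ui.1) => //; rewrite !twoE te.
  have hz : hom (act0 (s i v) (cx c i k v ⋆ z)) (act0 (s k v) z) (act1 (h i k v) (idn z)).
    by rewrite (act0_split HP _ _ (sS _ _ Ui)); exact: hom_act_idn.
  rewrite -(hom_cPA HP hK hW hz) step1 -(act_unit_cmp HP ui T1).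
  have hg := H1 i v g Ui.
  have hg' : hom (act0 (s i v) (tgt g)) (act0 (s i v) (x ⋆ tgt g')) (act1 (o i v) (idn x ⋅ g')).
    by have := H1 i v (idn x ⋅ g') Ui; rewrite -T1 !twoE.
  have hij' : hom (act0 (s i v) (x ⋆ tgt g')) (act0 (s j v) (tgt g')) (act1 (h i j v) (idn (tgt g'))).
    by rewrite (act0_split HP _ _ (sS _ _ Ui)); exact: hom_act_idn.
  have hijs : hom (act0 (s i v) (tgt g)) (act0 (s j v) (src g')) (act1 (h i j v) (idn (src g'))).
    by rewrite E (act0_split HP _ _ (sS _ _ Ui)); exact: hom_act_idn.
  have hjz : hom (act0 (s j v) (tgt g')) (act0 (s k v) z) (act1 (h j k v) (idn z)).
    by rewrite tz (act0_split HP _ _ (sS _ _ Uj)); exact: hom_act_idn.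
  rewrite (hom_cPA HP (hom_cP HP hg hg') hij' hjz) -(hom_cPA HP hg hg' hij').
  (* The second morphism's g' slides along h_ij from s_i x_ij to s_j, which separates the two
     images. *)
  rewrite (act1_split HP _ _ ui.1) -(act_splitl HP _ (unit_at_act HP x ui) hij).
  rewrite (act_splitr HP _ uj hij).
  have hog' := H1 j v g' Uj.
  by rewrite -(hom_cPA HP hg (hom_cP HP hijs hog') hjz) -(hom_cPA HP hijs hog' hjz)
    -(hom_cPA HP hg hijs (hom_cP HP hog' hjz)).
split.
  by move=> [[i v] x] z /= Ui; rewrite (act0_split HP _ _ (sS _ _ Ui)).
split.
  move=> [[[i j] v] g] g' [/= Ui Uj]; rewrite /F1.
  set z := y i j v g.
  have -> : y i j v (g ⋅ g') = z ⋆ tgt g' by rewrite /z /y tgt_mul mul0A.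
  have ui := frame_unit F Ui; have hij := frame_hom F Ui Uj.
  rewrite idn_mul (act1_split HP _ _ ui.1) (act1_split HP _ _ hij).
  have hz := H2 _ _ _ (tgt g) Ui Uj.
  by rewrite -(hom_cmp HP (H1 _ _ g Ui) hz) ?src_idn // cmp_idr.
split; first by move=> [[i v] x] /= Ui; rewrite projA ?(frame_sec F Ui).2 //; exact: sS.
split.
  apply: (within_act0 HP); [|by within_auto|by move=> [[i v] x] /= /sS].
  by apply: (within_idx1 (frame_sec_cont F)); within_auto.
rewrite /F1 /y; apply: (within_cP HP).
- apply: (within_act1 HP); [|by within_auto|].
    apply: (within_idx1 (frame_unit_cont F)); within_auto.
    by move=> [[[i j] v] g] [].
  by move=> [[[i j] v] g] [/= /(frame_unit F)[[]]].
- apply: (within_act1 HP); [|by within_auto|].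
    by apply: (within_idx2 (frame_hom_cont F)); within_auto.
  by move=> [[[i j] v] g] [/= Ui Uj]; case: (frame_hom F Ui Uj).
- move=> [[[i j] v] g] [/= Ui Uj].
  exact: hom_composable (H1 _ _ g Ui) (H2 _ _ _ _ Ui Uj).
Qed.

End Bundle.

(** * Surjectivity and injectivity of Gamma *)

Section Gamma.
Variables (G : twoGroup) (X : topologicalType).

Lemma bundle_morphism_refl (P : space2 G X) : bundle_morphism P P.
Proof.
exists id, id; do !split=> //; exact: within_id.
Qed.

Lemma principal_proj_act (P : space2 G X) : principal P ->
  forall (p : ob P) x, obS p -> proj (act0 p x) = proj p.
Proof.
move=> [HP [I [T [_ [covT chT]]]]] p x pS.
by have [i Ti] := covT (proj p); exact: chart_proj_act (chT i) pS Ti.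
Qed.

(** The closure ranges over all 2-space data, so principality is carried through the induction: in
    the transitive case the middle term must be principal to supply a cocycle through which both
    comparisons pass. *)
Lemma bundle_equiv_cech_eq (P Q : space2 G X) : bundle_equiv P Q ->
  (principal P <-> principal Q) /\
  (principal P -> forall (U V : ocover X) (c : cocycle G U) (c' : cocycle G V),
     presents P c -> presents Q c' -> cech_eq (existT _ U c) (existT _ V c')).
Proof.
elim=> {P Q} [P Q [pP [pQ [R [pR [RP RQ]]]]]|P|P Q _ [PQ IH]|P Q R _ [PQ IH1] _ [QR IH2]].
- split=> // _ U V c c' cP cQ; have [W [d dR]] := principal_presents pR.
  have dP := presents_morphism pR.1 RP dR; have dQ := presents_morphism pR.1 RQ dR.
  exact: rst_trans (presents_cech_eq pP cP dP) (presents_cech_eq pQ dQ cQ).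
- by split=> // pP U V c c'; exact: presents_cech_eq.
- split; first exact: iff_sym.
  by move=> /PQ pP U V c c' cQ cP; apply: rst_sym; exact: IH.
- split; first exact: iff_trans PQ QR.
  move=> pP U V c c' cP cR; have pQ := PQ.1 pP.
  have [W [d dQ]] := principal_presents pQ.
  exact: rst_trans (IH1 pP _ _ _ _ cP dQ) (IH2 pQ _ _ _ _ dQ cR).
Qed.

End Gamma.

Theorem theorem11 (G : twoGroup) (X : topologicalType) :
  (* Gamma is surjective *)
  (forall P : space2 G X, principal P ->
     exists (U : ocover X) (c : cocycle G U),
       is_cocycle c /\ bundle_equiv P (Pc c)) /\
  (* if X admits good covers, Gamma is also injective *)
  (admits_good_covers X ->
     forall (U V : ocover X) (c : cocycle G U) (c' : cocycle G V),
       is_cocycle c -> is_cocycle c' ->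
       bundle_equiv (Pc c) (Pc c') ->
       cech_eq (existT _ U c) (existT _ V c')).
Proof.
split=> [P pP|_ U V c c' cc cc' /bundle_equiv_cech_eq[_]].
  have [U [c Pc_]] := principal_presents pP; exists U, c; split; first exact: Pc_.1.
  have pc := pc_principal Pc_.1.
  (* The span has apex [Pc c], with the morphism given by the presentation on one side and the
     identity on the other. *)
  apply: rst_step; split=> //; split=> //; exists (Pc c); split=> //; split.
    exact: (presents_bundle_morphism Pc_.1 pP.1 (principal_proj_act pP) Pc_).
  exact: bundle_morphism_refl.
by apply; [exact: pc_principal|exact: pc_presents|exact: pc_presents].
Qed.
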